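(* Let $\mathcal A$ be a compact irreducible family of real $d\times d$ matrices. The linear switching system generated by $\mathcal A$ is uniform with $\sigma=0$ (i.e. $\sigma(A(\cdot))=0$ for every switching law $A(\cdot)$) if and only if there is a basis of $\mathbb R^d$ in which all matrices of $\mathcal A$ are antisymmetric ($A^T=-A$). In this case, every trajectory $x(t)$, $t\in[0,+\infty)$, lies on a Euclidean sphere (with respect to that basis).
   Context: Given a compact family $\mathcal A$ of real $d\times d$ matrices, the linear switching system (LSS) is the linear differential equation $\dot x(t)=A(t)x(t)$, $x(0)=x_0$, on $x:[0,+\infty)\to\mathbb R^d$, where $A(\cdot):[0,+\infty)\to\mathcal A$ is an arbitrary measurable function called the switching law. The solution $x(\cdot)$ is the trajectory corresponding to the switching law and the initial condition $x_0$. The exponent of growth of a switching law is $\sigma(A(\cdot))=\sup_{x_0\in\mathbb R^d}\limsup_{t\to\infty}\frac1t\log\|x(t)\|$, where $x$ is the trajectory with $x(0)=x_0$ (with $\log 0=-\infty$). The system is uniform if $\sigma(A(\cdot))$ is the same for all switching laws. The family $\mathcal A$ (and the LSS) is irreducible if there is no proper linear subspace of $\mathbb R^d$ (different from $\{0\}$ and $\mathbb R^d$) invariant for all $A\in\mathcal A$. *)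

(* Defs.v *)
(* MathComp-Analysis; R : realType stands for the field of real numbers. *)
From mathcomp Require Import all_boot all_order all_algebra.
From mathcomp Require Import all_classical all_reals all_analysis.

Set Implicit Arguments.
Unset Strict Implicit.
Unset Printing Implicit Defensive.

Import Order.TTheory GRing.Theory Num.Theory.
Import numFieldNormedType.Exports.

Local Open Scope classical_set_scope.
Local Open Scope ring_scope.

(* A copy of R carrying the sigma-algebra of Lebesgue measurable sets, which is
   the domain of completed_lebesgue_measure. *)
Notation lebesgueType R :=
  (caratheodory_type (mu_ext (wlength (@idfun R)))).

Definition lebesgue_measurable_fun (R : realType) (D : set R) (f : R -> R) :=
  measurable_fun (D : set (lebesgueType R)) (f : lebesgueType R -> R).

(* Only the values of A on [0, +oo[ are relevant.  Measurability of a
   matrix-valued function amounts to measurability of its entries. *)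
Definition switching_law (R : realType) (d : nat) (F : set 'M[R]_d)
    (A : R -> 'M[R]_d) : Prop :=
  (forall t : R, 0 <= t -> F (A t)) /\
  (forall i j, lebesgue_measurable_fun `[0, +oo[ (fun t => A t i j)).

(* Since A is merely measurable, x' = A x, x(0) = x0 is understood in the sense
   of Caratheodory: x is continuous on [0, +oo[ and
   x(t) = x0 + \int_0^t A(s) x(s) ds.  The integrand is bounded and measurable
   on [0, t] when A takes its values in a compact family. *)
Definition trajectory (R : realType) (d : nat) (A : R -> 'M[R]_d)
    (x0 : 'cV[R]_d) (x : R -> 'cV[R]_d) : Prop :=
  {within `[0, +oo[, continuous x} /\
  (forall t : R, 0 <= t -> forall i,
     x t i 0 = x0 i 0 +
       \int[@completed_lebesgue_measure R]_(s in `[0, t]) (A s *m x s) i 0).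

(* limsup_(t -> +oo) (1/t) log |x(t)|; lne 0 = -oo, and `|_| is the max norm,
   the value being the same for every norm on R^d. *)
Definition growth_rate (R : realType) (d : nat) (x : R -> 'cV[R]_d) : \bar R :=
  limf_esup (fun t : R => (t^-1%:E * lne `|x t|%:E)%E) (pinfty_nbhs R).

(* For a switching law the trajectory issued from x0 exists and is unique on
   [0, +oo[, so that the supremum is over x0. *)
Definition growth_exponent (R : realType) (d : nat) (A : R -> 'M[R]_d) :
    \bar R :=
  ereal_sup [set growth_rate x | x in [set x | exists x0, trajectory A x0 x]].

Definition uniform_with (R : realType) (d : nat) (F : set 'M[R]_d)
    (sigma : \bar R) : Prop :=
  forall A, switching_law F A -> growth_exponent A = sigma.

Definition irreducible_family (R : realType) (d : nat) (F : set 'M[R]_d) :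
    Prop :=
  forall V : {vspace 'cV[R]_d},
    (forall M, F M -> forall v, v \in V -> M *m v \in V) ->
    V = 0%VS \/ V = fullv.

(* The basis of R^d is given by the columns of an invertible matrix B. *)
Definition coords (R : realType) (d : nat) (B : 'M[R]_d) (v : 'cV[R]_d) :
    'cV[R]_d :=
  invmx B *m v.

Definition matrix_in_basis (R : realType) (d : nat) (B M : 'M[R]_d) :
    'M[R]_d :=
  invmx B *m M *m B.

Definition antisymmetric_in (R : realType) (d : nat) (F : set 'M[R]_d)
    (B : 'M[R]_d) : Prop :=
  forall M, F M -> (matrix_in_basis B M)^T = - matrix_in_basis B M.

(* The sphere centred at the origin for the Euclidean norm that makes the basis
   B orthonormal; r = 0 is allowed, for the zero trajectory. *)
Definition euclidean_sphere (R : realType) (d : nat) (B : 'M[R]_d) (r : R) :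
    set 'cV[R]_d :=
  [set v | Num.sqrt (\sum_i (coords B v) i 0 ^+ 2) = r].

(* Main.v *)
Require Import Defs.
From mathcomp Require Import all_boot all_order all_algebra.
From mathcomp Require Import all_classical all_reals all_analysis.
From mathcomp Require Import ring lra.
Import Order.TTheory GRing.Theory Num.Theory.
Import numFieldNormedType.Exports.
Local Open Scope classical_set_scope.
Local Open Scope ring_scope.

Set Implicit Arguments.
Unset Strict Implicit.
Unset Printing Implicit Defensive.

(* If all matrices are antisymmetric for a scalar product Q, then along a
   trajectory the increment of Q (x t) over [s, t] is O((t - s)^2), so Q (x t) is
   constant; as trajectories exist (Picard iteration), the exponent is 0.

   Conversely, let S be the monoid generated by the flows of the matrices of the
   family over dyadic times.  If S were unbounded, irreducibility and the
   compactness of the sphere would give finitely many words one of which doubles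
   any given vector, and chaining them would give a law of positive exponent.  If
   S contained a contraction, repeating it would give a law of negative exponent.
   So S is an irreducible bounded monoid of invertible matrices that stays away
   from 0.  An element of minimal rank in its closure yields a nonzero quadratic
   form that is constant along the orbits of suitable spanning vectors, which
   bounds the inverses of the elements of S; S then preserves a scalar product,
   and differentiating at time 0 gives the antisymmetry. *)

(** * Quadratic increments and the Lebesgue integral *)

(** The flows of a switching system form a monoid, not a group: an inverse would run time backwards.
    Bounds above and away from 0 do not by themselves bound the inverses, as the powers of diag(1,
    1/2) show. Irreducibility has to exclude this, and an element of minimal rank is the device: on
    its image the closure acts through a compact set of invertible matrices. Time steps are dyadic
    so that any two words can be refined to a common step, and any word can be played by a law that
    is constant on equal cells. Laws are merely measurable, so arguments by differentiation are
    replaced by increments with an error O((t - s)^2), whose sum over a fine subdivision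
    vanishes. *)

Lemma invS_mul_le0 (R : realType) (x c : R) :
  (forall n : nat, x <= c / n.+1%:R) -> x <= 0.
Proof.
move=> H; rewrite leNgt; apply/negP => x0.
have c0 : 0 < c by have := H 0%N; rewrite divr1; apply: lt_le_trans.
have := H (Num.truncn (c / x)); apply/negP; rewrite -ltNge.
rewrite ltr_pdivrMr ?ltr0n// mulrC -ltr_pdivrMr//.
exact: truncnS_gt.
Qed.

(** Over n + 1 equal steps the increments add up to at most C (b - a)^2 / (n + 1), which tends to 0.
    This replaces the sign of a derivative, which a trajectory may lack at some times. *)
Lemma quad_incr_le (R : realType) (f : R -> R) (a b C : R) : a <= b ->
  (forall s t, a <= s -> s <= t -> t <= b -> f t - f s <= C * (t - s) ^+ 2) ->
  f b <= f a.
Proof.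
move=> ab H; rewrite -subr_le0.
apply: (@invS_mul_le0 _ _ (C * (b - a) ^+ 2)) => n.
set h := (b - a) / n.+1%:R.
have h0 : 0 <= h by rewrite divr_ge0// subr_ge0.
have hn : n.+1%:R * h = b - a by rewrite /h mulrC divfK// pnatr_eq0.
have step j : (j <= n.+1)%N -> f (a + j%:R * h) - f a <= j%:R * (C * h ^+ 2).
  elim: j => [|j IH] jn; first by rewrite mul0r addr0 subrr mul0r.
  have jb : a + j.+1%:R * h <= b.
    rewrite -lerBrDl -hn ler_wpM2r// ler_nat//.
  have e : a + j.+1%:R * h - (a + j%:R * h) = h by rewrite -natr1; ring.
  have := H (a + j%:R * h) (a + j.+1%:R * h) _ _ jb.
  rewrite e lerDl mulr_ge0// => /(_ isT).
  rewrite lerD2l ler_wpM2r ?ler_nat// => /(_ isT).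
  have := IH (ltnW jn); rewrite -natr1 mulrDl; lra.
have := step n.+1 (leqnn _); rewrite hn (_ : a + (b - a) = b); last by ring.
move=> /le_trans; apply; rewrite -hn.
suff -> : C * (n.+1%:R * h) ^+ 2 / n.+1%:R = n.+1%:R * (C * h ^+ 2) by [].
by field.
Qed.

Lemma quad_incr_eq (R : realType) (f : R -> R) (a b C : R) : a <= b ->
  (forall s t, a <= s -> s <= t -> t <= b -> `|f t - f s| <= C * (t - s) ^+ 2) ->
  f b = f a.
Proof.
move=> ab H; apply/eqP; rewrite eq_le (quad_incr_le (C := C) ab)/=; last first.
  by move=> s t *; exact: le_trans (ler_norm _) (H _ _ _ _ _).
rewrite -lerN2; apply: (@quad_incr_le _ (fun t => - f t) _ _ C) => //.
by move=> s t *; rewrite -opprD; apply: le_trans (ler_norm _) _; rewrite normrN H.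
Qed.

(* The weight exp(-K t) reduces the claim to [quad_incr_le], because
   (1 + K h) exp(-K h) <= 1. *)
Lemma quad_gronwall (R : realType) (f : R -> R) (a b K C : R) : a <= b -> 0 <= K ->
  (forall t, a <= t -> t <= b -> 0 <= f t) ->
  (forall s t, a <= s -> s <= t -> t <= b ->
     f t <= (1 + K * (t - s)) * f s + C * (t - s) ^+ 2) ->
  f b <= expR (K * (b - a)) * f a.
Proof.
move=> ab K0 f0 H.
have : expR (- K * b) * f b <= expR (- K * a) * f a.
  apply: (@quad_incr_le _ (fun t => expR (- K * t) * f t) a b (expR (- K * a) * `|C|)) => //.
  move=> s t a_s st tb; have fs0 : 0 <= f s by rewrite f0// (le_trans st).
  have e0 : expR (- K * t) <= expR (- K * a).
    by rewrite ler_expR !mulNr lerN2 ler_wpM2l// (le_trans a_s).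
  rewrite lerBlDr.
  apply: (@le_trans _ _ (expR (- K * t) * ((1 + K * (t - s)) * f s) +
                         expR (- K * t) * (C * (t - s) ^+ 2))).
    by rewrite -mulrDr ler_wpM2l ?expR_ge0// H.
  rewrite addrC lerD//.
    rewrite -mulrA; apply: (@le_trans _ _ (expR (- K * t) * (`|C| * (t - s) ^+ 2))).
      by rewrite ler_wpM2l ?expR_ge0// ler_wpM2r ?sqr_ge0// ler_norm.
    by rewrite ler_wpM2r// mulr_ge0// sqr_ge0.
  rewrite mulrA ler_wpM2r//.
  have -> : - K * s = - K * t + K * (t - s) by ring.
  by rewrite expRD ler_wpM2l ?expR_ge0// expR_ge1Dx.
rewrite !mulNr => H1.
have -> : expR (K * (b - a)) = expR (K * b) * expR (- (K * a)) by rewrite -expRD; congr expR; ring.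
rewrite -mulrA; apply: le_trans (ler_wpM2l (expR_ge0 _) H1).
by rewrite mulrA -expRD subrr expR0 mul1r.
Qed.

(** * Primitives for the Lebesgue integral *)

Definition locally_bounded (R : realType) (f : R -> R) :=
  forall T : R, exists M, forall u, 0 <= u -> u <= T -> `|f u| <= M.

Definition primitive (R : realType) (f : R -> R) (t : R) : R :=
  \int[@completed_lebesgue_measure R]_(s in `[0, t]) f s.

Lemma completed_measurable (R : realType) (D : set R) :
  measurable (D : set (measurableTypeR R)) -> measurable (D : set (lebesgueType R)).
Proof. exact: sub_caratheodory. Qed.

Lemma completed_integrable (R : realType) (f : R -> R) (i : interval R) (T : R) :
  lebesgue_measurable_fun `[0, +oo[ f -> locally_bounded f ->
  [set` i] `<=` `[0, T]%classic ->
  (@completed_lebesgue_measure R).-integrable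
    ([set` i] : set (lebesgueType R)) (EFin \o (f : lebesgueType R -> R)).
Proof.
move=> mf bf iT.
have mi : measurable ([set` i] : set (lebesgueType R)) by exact: completed_measurable.
apply: measurable_bounded_integrable => //.
- rewrite -[X in (X < _)%E]/(@lebesgue_measure R [set` i]).
  apply: (@le_lt_trans _ _ (@lebesgue_measure R `[0, T]%classic)).
    by apply: le_measure => //; rewrite inE//.
  by rewrite lebesgue_measure_itv/=; case: ifP => // _; rewrite -EFinD ltry.
- apply: measurable_funS mf.
    by apply: completed_measurable.
  by move=> x /iT /=; rewrite !in_itv/= andbT => /andP[].
- have [M HM] := bf T; exists M; split; first exact: num_real.
  move=> M' MM' x /= /iT; rewrite /= in_itv/= => /andP[x0 xT].
  exact: le_trans (HM _ x0 xT) (ltW MM').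
Qed.

(** The bound is asked for on the open interval only, so that it applies to a law known between two
    switching times; the endpoint t has measure 0. *)
Lemma primitive_incr (R : realType) (f : R -> R) (s t c M : R) :
  lebesgue_measurable_fun `[0, +oo[ f -> locally_bounded f ->
  0 <= s -> s <= t -> (forall u, s < u -> u < t -> `|f u - c| <= M) ->
  `|primitive f t - primitive f s - (t - s) * c| <= (t - s) * M.
Proof.
move=> mf bf s0; rewrite le_eqVlt => /predU1P[->|st] H.
  by rewrite !subrr !mul0r subrr normr0.
have sub (i : interval R) : [set` i] `<=` `[0, t]%classic ->
    (@completed_lebesgue_measure R).-integrable
    ([set` i] : set (lebesgueType R)) (EFin \o (f : lebesgueType R -> R)).
  exact: completed_integrable.
have mi (i : interval R) : measurable ([set` i] : set (lebesgueType R)).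
  exact: completed_measurable.
have e1 : `[0, t]%classic = `[0, s] `|` `]s, t] :> set R.
  rewrite -itv_bndbnd_setU// bnd_simp//; exact: ltW.
have e2 : `]s, t]%classic = `]s, t[ `|` `[t, t] :> set R.
  by rewrite -itv_bndbnd_setU// bnd_simp.
have d1 : [disjoint (`[0, s]%classic : set (lebesgueType R)) & `]s, t]%classic].
  apply/disj_setPS => y [/=]; rewrite 2!in_itv/= => /andP[_ yx] /andP[].
  by rewrite ltNge yx.
have d2 : [disjoint (`]s, t[%classic : set (lebesgueType R)) & `[t, t]%classic].
  apply/disj_setPS => y [/=]; rewrite 2!in_itv/= => /andP[_ yx] /andP[].
  by rewrite leNgt yx.
have i1 : primitive f t = primitive f s +
    \int[@completed_lebesgue_measure R]_(u in `]s, t]) f u.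
  rewrite /primitive [in LHS]e1 Rintegral_setU//.
  by rewrite -e1; exact: sub.
have i2 : \int[@completed_lebesgue_measure R]_(u in `]s, t]) f u =
    \int[@completed_lebesgue_measure R]_(u in `]s, t[) f u.
  have iot : (@completed_lebesgue_measure R).-integrable
    (`]s, t] : set (lebesgueType R)) (EFin \o (f : lebesgueType R -> R)).
    by apply: sub => x /=; rewrite !in_itv/= => /andP[sx ->]; rewrite andbT (le_trans s0)// ltW.
  rewrite [in LHS]e2 Rintegral_setU//; last by rewrite -e2.
  rewrite [X in _ + X = _](_ : _ = 0) ?addr0//.
  rewrite /Rintegral (@null_set_integral _ (lebesgueType R) R
    (@completed_lebesgue_measure R)); [by []|exact: mi| |].
    apply: (measurable_int (@completed_lebesgue_measure R)); apply: sub.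
    move=> x /=; rewrite !in_itv/= => /andP[tx ->].
    by rewrite andbT (le_trans _ tx)// (le_trans s0)// ltW.
  by rewrite -[LHS]/(@lebesgue_measure R `[t, t]%classic) lebesgue_measure_itv/= ltxx.
rewrite i1 i2 (addrC (primitive f s)) addrK.
have iof : (@completed_lebesgue_measure R).-integrable
    (`]s, t[ : set (lebesgueType R)) (EFin \o (f : lebesgueType R -> R)).
  by apply: sub => x /=; rewrite !in_itv/= => /andP[sx /ltW ->]; rewrite andbT (le_trans s0)// ltW.
have mst : fine (@completed_lebesgue_measure R (`]s, t[%classic : set (lebesgueType R))) = t - s.
  by rewrite -[X in fine X]/(@lebesgue_measure R `]s, t[%classic) lebesgue_measure_itv/= lte_fin st.
have ic r : (@completed_lebesgue_measure R).-integrable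
    (`]s, t[ : set (lebesgueType R)) (EFin \o ((fun=> r) : lebesgueType R -> R)).
  apply: measurable_bounded_integrable => //.
    rewrite -[X in (X < _)%E]/(@lebesgue_measure R `]s, t[%classic).
    by rewrite lebesgue_measure_itv/= lte_fin st -EFinD ltry.
  by exists `|r|; split; [exact: num_real|move=> x xr y _; exact: ltW].
have := Rintegral_cst (@completed_lebesgue_measure R) (mi `]s, t[) c.
have := Rintegral_cst (@completed_lebesgue_measure R) (mi `]s, t[) M.
rewrite mst => eM eC.
rewrite [_ * c]mulrC [_ * M]mulrC -eC -eM -RintegralB//.
apply: le_trans (le_normr_Rintegral _ _) _ => //.
  by have := @integrableB _ _ _ (@completed_lebesgue_measure R) _ (mi `]s, t[) _ _ iof (ic c).
apply: le_Rintegral => //.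
  have := @integrableB _ _ _ (@completed_lebesgue_measure R) _ (mi `]s, t[) _ _ iof (ic c).
  by move/integrable_abse.
by move=> u /=; rewrite in_itv/= => /andP[su ut]; exact: H.
Qed.

Lemma normmx_ge (R : realType) m n (A : 'M[R]_(m, n)) i j : `|A i j| <= `|A|.
Proof.
by rewrite [leRHS]/Num.Def.normr/= mx_normrE; apply/bigmax_geP; right => /=; exists (i, j).
Qed.

Lemma normmx_le (R : realType) m n (A : 'M[R]_(m, n)) (M : R) : 0 <= M ->
  (forall i j, `|A i j| <= M) -> `|A| <= M.
Proof.
move=> M0 H; rewrite [leLHS]/Num.Def.normr/= mx_normrE; apply/bigmax_leP.
by split=> // -[i j] _ /=.
Qed.

Lemma normmx_mul (R : realType) m n p (A : 'M[R]_(m, n)) (B : 'M[R]_(n, p)) :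
  `|A *m B| <= n%:R * `|A| * `|B|.
Proof.
apply: normmx_le => [|i j]; first by rewrite !mulr_ge0.
rewrite mxE; apply: le_trans (ler_norm_sum _ _ _) _.
apply: le_trans (_ : \sum_(k < n) `|A| * `|B| <= _).
  by apply: ler_sum => k _; rewrite normrM ler_pM// normmx_ge.
by rewrite sumr_const card_ord -mulrA mulr_natl.
Qed.

Definition locally_integrable (R : realType) (f : R -> R) :=
  lebesgue_measurable_fun `[0, +oo[ f /\ locally_bounded f.

Lemma locally_integrable_lin (R : realType) (f g : R -> R) a :
  locally_integrable f -> locally_integrable g ->
  locally_integrable (fun s => a * f s + g s).
Proof.
move=> [mf bf] [mg bg]; split.
  apply: (@measurable_realfun.measurable_funD _ (lebesgueType R) R _ (fun s => a * f s) g);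
    last exact: mg.
  exact: (@measurable_realfun.measurable_funM _ (lebesgueType R) R _ (fun=> a) f
    (measurable_cst _) mf).
move=> T; have [M HM] := bf T; have [N HN] := bg T.
exists (`|a| * M + N) => u u0 uT; apply: le_trans (ler_normD _ _) _.
by rewrite normrM lerD ?ler_wpM2l ?HM ?HN.
Qed.

Lemma primitive0 (R : realType) (f : R -> R) : locally_integrable f -> primitive f 0 = 0.
Proof.
move=> [mf bf]; rewrite /primitive /Rintegral
  (@null_set_integral _ (lebesgueType R) R (@completed_lebesgue_measure R)); first by [].
- exact: completed_measurable.
- apply: (measurable_int (@completed_lebesgue_measure R)).
  exact: (completed_integrable (T := 0)).
- by rewrite -[LHS]/(@lebesgue_measure R `[0, 0]%classic) lebesgue_measure_itv/= ltxx.
Qed.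

Lemma primitive_lin (R : realType) (f g : R -> R) a t :
  locally_integrable f -> locally_integrable g ->
  primitive (fun s => a * f s + g s) t = a * primitive f t + primitive g t.
Proof.
move=> [mf bf] [mg bg].
have If := completed_integrable mf bf (@subset_refl _ `[0, t]%classic).
have Ig := completed_integrable mg bg (@subset_refl _ `[0, t]%classic).
have m0t : measurable (`[0, t]%classic : set (lebesgueType R)).
  exact: completed_measurable.
rewrite /primitive RintegralD//; last first.
  by have := integrableZl (mu := @completed_lebesgue_measure R) m0t a If.
by rewrite RintegralZl.
Qed.

Lemma locally_integrable_sum (R : realType) (I : Type) (r : seq I) (f : I -> R -> R)
    (p : I -> R) : (forall i, locally_integrable (f i)) ->
  locally_integrable (fun s => \sum_(i <- r) p i * f i s).
Proof.
move=> H; elim: r => [|i r IH].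
  under eq_fun do rewrite big_nil.
  by split; [exact: measurable_cst|move=> T; exists 0 => u _ _; rewrite normr0].
under eq_fun do rewrite big_cons.
exact: locally_integrable_lin.
Qed.

Lemma primitive_sum (R : realType) (I : Type) (r : seq I) (f : I -> R -> R)
    (p : I -> R) t : (forall i, locally_integrable (f i)) ->
  primitive (fun s => \sum_(i <- r) p i * f i s) t = \sum_(i <- r) p i * primitive (f i) t.
Proof.
move=> H; elim: r => [|i r IH].
  under [in LHS]eq_fun do rewrite big_nil.
  rewrite big_nil /primitive Rintegral_cst ?mul0r//.
  exact: completed_measurable.
under [in LHS]eq_fun do rewrite big_cons.
by rewrite primitive_lin ?IH ?big_cons//; exact: locally_integrable_sum.
Qed.

Lemma primitive_le (R : realType) (f : R -> R) (s t M : R) : locally_integrable f ->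
  0 <= s -> s <= t -> (forall u, s < u -> u < t -> `|f u| <= M) ->
  `|primitive f t - primitive f s| <= (t - s) * M.
Proof.
move=> [mf bf] s0 st H.
have := @primitive_incr _ f s t 0 M mf bf s0 st; rewrite mulr0 subr0; apply => u su ut.
by rewrite subr0 H.
Qed.

(** M / L exp(L t) is a primitive of the bound, so for e = 1 and e = -1 the increments of e
    [primitive f] - M / L exp(L t) are at most quadratic and [quad_incr_le] applies. The factor 1 /
    L is what makes a Picard step contract. *)
Lemma primitive_expR_le (R : realType) (f : R -> R) (M L t : R) : locally_integrable f ->
  0 < L -> 0 <= M -> (forall u, 0 <= u -> `|f u| <= M * expR (L * u)) ->
  0 <= t -> `|primitive f t| <= M / L * expR (L * t).
Proof.
move=> lf L0 M0 H t0.
have key (e : R) : `|e| = 1 -> e * primitive f t <= M / L * expR (L * t).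
  move=> e1; rewrite -subr_le0.
  have /(_ t0) := @quad_incr_le _ (fun u => e * primitive f u - M / L * expR (L * u)) 0 t
    (M * L * expR (L * t)).
  have ML0 : 0 <= M / L * expR (L * 0) by rewrite mulr_ge0 ?expR_ge0 ?divr_ge0// ltW.
  rewrite primitive0// mulr0 sub0r => H1; apply: (le_trans (H1 _)); last by rewrite oppr_le0.
  move=> u v u0 uv vt.
  have h1 : e * (primitive f v - primitive f u) <= (v - u) * (M * expR (L * v)).
    apply: le_trans (ler_norm _) _; rewrite normrM e1 mul1r.
    apply: primitive_le => // w uw wv; apply: le_trans (H _ _) _.
      by rewrite (le_trans u0)// ltW.
    by rewrite ler_wpM2l// ler_expR ler_wpM2l ?ltW.
  have h2 : L * (v - u) * expR (L * u) <= expR (L * v) - expR (L * u).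
    have -> : L * v = L * u + L * (v - u) by ring.
    have := expR_ge1Dx (L * (v - u)); have := expR_gt0 (L * u); rewrite expRD; nra.
  have h3 : expR (L * v) - expR (L * u) <= L * (v - u) * expR (L * v).
    have -> : L * u = L * v + (- (L * (v - u))) by ring.
    have := expR_ge1Dx (- (L * (v - u))); have := expR_gt0 (L * v); rewrite expRD; nra.
  have h4 : (M / L) * (L * (v - u) * expR (L * u)) <= (M / L) * (expR (L * v) - expR (L * u)).
    by rewrite ler_wpM2l// divr_ge0// ltW.
  have h5 : (M / L) * (L * (v - u) * expR (L * u)) = M * (v - u) * expR (L * u).
    by field; rewrite gt_eqF.
  have h6 : M * (v - u) * (expR (L * v) - expR (L * u)) <=
      M * (v - u) * (L * (v - u) * expR (L * t)).
    apply: ler_wpM2l; first by rewrite mulr_ge0// subr_ge0.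
    apply: le_trans h3 _; rewrite ler_wpM2l ?ler_expR ?ler_wpM2l// ?(ltW L0)//.
    by rewrite mulr_ge0 ?subr_ge0// ltW.
  rewrite h5 in h4; nra.
rewrite ler_norml; apply/andP; split.
  by rewrite lerNl -mulN1r key// normrN1.
by have := key 1; rewrite normr1 mul1r; exact.
Qed.

(** * Locally Lipschitz and continuous functions *)

Definition locally_lipschitz (R : realType) (d : nat) (x : R -> 'cV[R]_d) :=
  forall T, exists2 C, 0 <= C &
    forall s t, 0 <= s -> s <= t -> t <= T -> `|x t - x s| <= C * (t - s).

Lemma locally_lipschitz_continuous (R : realType) d (x : R -> 'cV[R]_d) :
  locally_lipschitz x -> {within `[0, +oo[, continuous x}.
Proof.
move=> lx; apply/subspace_continuousP => t /=; rewrite in_itv/= andbT => t0.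
have [C C0 HC] := lx (t + 1).
apply/cvgrPdist_le => e e0.
pose r := Num.min 1 (e / (C + 1)).
have r0 : 0 < r by rewrite lt_min ltr01 divr_gt0// ltr_wpDl.
rewrite near_withinE; apply/nbhs_ballP; exists r => //= u.
rewrite /ball/= => tu; rewrite in_itv/= andbT => u0.
have /andP[tu1 tu2] : (`|t - u| < 1) && (`|t - u| < e / (C + 1)) by rewrite -lt_min.
have Cr : C * `|t - u| <= e.
  rewrite ltr_pdivlMr ?ltr_wpDl// in tu2; have := normr_ge0 (t - u); nra.
have [ut|/ltW ut] := leP u t.
  apply: le_trans (HC _ _ u0 ut _) _; first by rewrite lerDl.
  by rewrite ger0_norm ?subr_ge0// in Cr.
rewrite distrC; apply: le_trans (HC _ _ t0 ut _) _.
  by move: tu1; rewrite distrC ger0_norm ?subr_ge0//; lra.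
by rewrite distrC ger0_norm ?subr_ge0// in Cr.
Qed.

Lemma within_continuous_coord (R : realType) d (x : R -> 'cV[R]_d) i :
  {within `[0, +oo[, continuous x} ->
  {within `[0, +oo[, continuous (fun t => x t i 0)}.
Proof.
move=> cx t; apply: (@continuous_comp _ _ _ (x : subspace _ -> _) (fun v : 'cV[R]_d => v i 0)).
  exact: cx.
exact: coord_continuous.
Qed.

Lemma continuous_lebesgue_measurable (R : realType) (f : R -> R) :
  {within `[0, +oo[, continuous f} -> lebesgue_measurable_fun `[0, +oo[ f.
Proof.
move=> cf mD Y mY.
apply: completed_measurable.
by apply: (measurable_realfun.subspace_continuous_measurable_fun _ cf).
Qed.

Lemma continuous_bounded (R : realType) d (x : R -> 'cV[R]_d) T :
  {within `[0, +oo[, continuous x} ->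
  exists2 M, 0 <= M & forall u, 0 <= u -> u <= T -> `|x u| <= M.
Proof.
move=> cx.
have cT : {within `[0, T], continuous x}.
  apply: continuous_subspaceW cx => u /=; rewrite !in_itv/= andbT.
  by case/andP.
have /compact_bounded [M [_ HM]] := continuous_compact cT (@segment_compact _ _ _).
exists (`|M| + 1) => [|u u0 uT]; first by rewrite addr_ge0.
apply: HM; first by rewrite (le_lt_trans (ler_norm M))// ltrDl.
by exists u => //=; rewrite in_itv/= u0.
Qed.

(** * Trajectories *)

Definition bounded_law (R : realType) d (A : R -> 'M[R]_d) (K : R) : Prop :=
  [/\ 0 < K, (forall t, 0 <= t -> forall v : 'cV[R]_d, `|A t *m v| <= K * `|v|) &
    (forall i j, lebesgue_measurable_fun `[0, +oo[ (fun t => A t i j))].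

Lemma law_field_integrable (R : realType) d (A : R -> 'M[R]_d) K (x : R -> 'cV[R]_d) i :
  bounded_law A K -> {within `[0, +oo[, continuous x} ->
  locally_integrable (fun s => (A s *m x s) i 0).
Proof.
move=> [K0 AK mA] cx; split.
  rewrite [X in lebesgue_measurable_fun _ X](_ : _ = fun s => \sum_k A s i k * x s k 0); last first.
    by apply/funext => s; rewrite mxE.
  apply: (@measurable_sum _ (lebesgueType R) R) => k.
  apply: (@measurable_realfun.measurable_funM _ (lebesgueType R) R _ (fun s => A s i k)
    (fun s => x s k 0)); first exact: mA.
  exact/continuous_lebesgue_measurable/within_continuous_coord.
move=> T; have [M M0 HM] := continuous_bounded T cx.
exists (K * M) => u u0 uT; apply: le_trans (normmx_ge _ _ _) _.
apply: le_trans (AK _ u0 _) _; rewrite ler_wpM2l ?HM// ltW//.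
Qed.

Lemma primitive_lipschitz (R : realType) d (f : 'I_d -> R -> R) (x0 : 'cV[R]_d) :
  (forall i, locally_integrable (f i)) ->
  locally_lipschitz (fun t => \col_i (x0 i 0 + primitive (f i) t)).
Proof.
move=> lf T.
have /choice[M HM] : forall i, exists M, forall u, 0 <= u -> u <= T -> `|f i u| <= M.
  by move=> i; have [_ ] := lf i; exact.
have M0 i : 0 <= `|M i| by [].
exists (\sum_i `|M i|) => [|s t s0 st tT]; first exact: sumr_ge0.
apply: normmx_le => [|i j]; first by rewrite mulr_ge0 ?sumr_ge0 ?subr_ge0.
rewrite !mxE opprD addrACA subrr add0r mulrC.
apply: primitive_le => // u su ut; apply: le_trans (HM _ _ _ _) _.
- by rewrite (le_trans s0)// ltW.
- by rewrite (le_trans _ tT)// ltW.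
- by rewrite (bigD1 i)//= (le_trans (ler_norm (M i)))// lerDl sumr_ge0.
Qed.

(** A trajectory is a primitive of a locally bounded field. The Lipschitz bound is what makes later
    first-order errors over [s, t] quadratic in t - s. *)
Lemma trajectory_lipschitz (R : realType) d (A : R -> 'M[R]_d) K x0 x :
  bounded_law A K -> trajectory A x0 x -> locally_lipschitz x.
Proof.
move=> bA [cx xE] T; have lf i := law_field_integrable i bA cx.
have [C C0 HC] := primitive_lipschitz x0 lf T.
exists C => // s t s0 st tT.
suff E u : 0 <= u -> x u = \col_i (x0 i 0 + primitive (fun s => (A s *m x s) i 0) u).
  by rewrite !E ?(le_trans s0)// HC.
by move=> u0; apply/colP => i; rewrite mxE xE.
Qed.

(** Nested intervals: u n - 2 b / 2^n increases, u n + 2 b / 2^n decreases, and the supremum of the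
    former lies in all the intervals, which yields the rate at once. *)
Lemma geometric_limit (R : realType) (u : nat -> R) (b : R) :
  (forall n, `|u n.+1 - u n| <= b / 2 ^+ n) ->
  exists l, forall n, `|l - u n| <= 2 * b / 2 ^+ n.
Proof.
move=> H.
have b0 : 0 <= b by have := H 0%N; rewrite expr0 divr1; apply: le_trans.
have halves n : 2 * b / 2 ^+ n.+1 = b / 2 ^+ n.
  by rewrite exprS; field; rewrite expf_neq0.
have twice n : 2 * b / 2 ^+ n = b / 2 ^+ n + b / 2 ^+ n by ring.
pose lo n := u n - 2 * b / 2 ^+ n; pose hi n := u n + 2 * b / 2 ^+ n.
have lohom n m : (n <= m)%N -> lo n <= lo m.
  move: n m; apply/nondecreasing_seqP => n.
  by have := H n; rewrite ler_norml /lo halves twice; lra.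
have hihom n m : (n <= m)%N -> hi m <= hi n.
  move: n m; apply/nonincreasing_seqP => n.
  by have := H n; rewrite ler_norml /hi halves twice; lra.
have lohi n m : lo n <= hi m.
  apply: le_trans (lohom _ (maxn n m) (leq_maxl _ _)) _.
  apply: le_trans (hihom m (maxn n m) (leq_maxr _ _)).
  have : 0 <= 2 * b / 2 ^+ maxn n m by rewrite !mulr_ge0// invr_ge0 exprn_ge0.
  by rewrite /lo /hi; lra.
exists (sup (range lo)) => n; rewrite ler_norml.
have h1 : sup (range lo) <= hi n.
  by apply: ge_sup => [|_ [m _ <-]]; [exists (lo 0%N), 0%N|].
have h2 : lo n <= sup (range lo).
  by apply: ub_le_sup; [exists (hi 0%N) => _ [m _ <-]|exists n].
by rewrite /lo /hi in h1 h2; lra.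
Qed.

Lemma le0_geometric (R : realType) (x c : R) : (forall n, x <= c / 2 ^+ n) -> x <= 0.
Proof.
move=> H; apply: (@invS_mul_le0 _ _ `|c|) => n.
apply: le_trans (H n) _; apply: le_trans (ler_wpM2r _ (ler_norm c)) _.
  by rewrite invr_ge0 exprn_ge0.
rewrite ler_wpM2l// lef_pV2 ?posrE ?exprn_gt0 ?ltr0n//.
by rewrite -natrX ler_nat ltn_expl.
Qed.

(** * Picard iteration *)

Fixpoint picard (R : realType) d (A : R -> 'M[R]_d) (x0 : 'cV[R]_d) n : R -> 'cV[R]_d :=
  if n is n'.+1 then
    fun t => \col_i (x0 i 0 + primitive (fun s => (A s *m picard A x0 n' s) i 0) t)
  else fun=> x0.

Lemma picard_lipschitz (R : realType) d (A : R -> 'M[R]_d) K x0 n :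
  bounded_law A K -> locally_lipschitz (picard A x0 n).
Proof.
move=> bA; elim: n => [T|n IH] /=.
  by exists 0 => // s t *; rewrite subrr normr0 mul0r.
apply: primitive_lipschitz => i; apply: (law_field_integrable _ bA).
exact: locally_lipschitz_continuous.
Qed.

Lemma primitive_field_sub (R : realType) d (A : R -> 'M[R]_d) K (x y : R -> 'cV[R]_d) i t :
  bounded_law A K -> locally_lipschitz x -> locally_lipschitz y ->
  primitive (fun s => (A s *m x s) i 0) t - primitive (fun s => (A s *m y s) i 0) t =
  primitive (fun s => (A s *m (x s - y s)) i 0) t.
Proof.
move=> bA lx ly.
have Ix := law_field_integrable i bA (locally_lipschitz_continuous lx).
have Iy := law_field_integrable i bA (locally_lipschitz_continuous ly).
rewrite addrC -mulN1r -primitive_lin//; congr primitive.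
by apply/funext => s; rewrite mulmxBr !mxE mulN1r addrC.
Qed.

Lemma locally_lipschitzB (R : realType) d (x y : R -> 'cV[R]_d) :
  locally_lipschitz x -> locally_lipschitz y -> locally_lipschitz (fun t => x t - y t).
Proof.
move=> lx ly T; have [C C0 HC] := lx T; have [D D0 HD] := ly T.
exists (C + D) => [|s t s0 st tT]; first exact: addr_ge0.
rewrite opprD addrACA; apply: le_trans (ler_normD _ _) _.
by rewrite mulrDl lerD ?HC// -opprD normrN HD.
Qed.

(* The weight exp(2 K t) turns a Picard step into a contraction of ratio 1/2. *)
Lemma picard_step (R : realType) d (A : R -> 'M[R]_d) K x0 n t :
  bounded_law A K -> 0 <= t ->
  `|picard A x0 n.+1 t - picard A x0 n t| <= `|x0| / 2 ^+ n * expR (2 * K * t).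
Proof.
move=> bA; have [K0 AK mA] := bA.
have K20 : 0 < 2 * K by rewrite mulr_gt0.
have half (c : R) : K * c / (2 * K) = c / 2 by field; rewrite gt_eqF.
elim: n t => [|n IH] t t0.
  apply: normmx_le => [|i j]; first by rewrite !mulr_ge0 ?expR_ge0 ?invr_ge0 ?exprn_ge0.
  rewrite expr0 divr1 ord1 /= !mxE addrAC subrr add0r.
  apply: (@le_trans _ _ (K * `|x0| / (2 * K) * expR (2 * K * t))); last first.
    rewrite half ler_wpM2r ?expR_ge0// ler_piMr//; lra.
  apply: primitive_expR_le => //.
  - apply: (law_field_integrable _ bA); apply: locally_lipschitz_continuous => T.
    by exists 0 => // *; rewrite subrr normr0 mul0r.
  - by rewrite mulr_ge0// ltW.
  - move=> u u0; apply: le_trans (normmx_ge _ _ _) _.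
    apply: le_trans (AK _ u0 _) _; rewrite ler_peMr ?mulr_ge0 ?(ltW K0)//.
    by rewrite -[X in X <= _]expR0 ler_expR mulr_ge0// ltW.
apply: normmx_le => [|i j]; first by rewrite !mulr_ge0 ?expR_ge0 ?invr_ge0 ?exprn_ge0.
rewrite ord1; pose y m := picard A x0 m.
have ly m : locally_lipschitz (y m) by exact: picard_lipschitz bA.
rewrite [picard A x0 n.+2]/= [in X in _ - X]/= !mxE opprD addrACA subrr add0r -/(y n.+1) -/(y n).
rewrite (primitive_field_sub i t bA (ly n.+1) (ly n)).
have -> : `|x0| / 2 ^+ n.+1 = K * (`|x0| / 2 ^+ n) / (2 * K).
  by rewrite half exprS; field; rewrite expf_neq0.
apply: primitive_expR_le => //.
- apply: (law_field_integrable _ bA); apply: locally_lipschitz_continuous.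
  exact: locally_lipschitzB (ly n.+1) (ly n).
- by rewrite !mulr_ge0 ?invr_ge0 ?exprn_ge0// ltW.
- move=> u u0; apply: le_trans (normmx_ge _ _ _) _; apply: le_trans (AK _ u0 _) _.
  by rewrite -mulrA ler_wpM2l ?IH// ltW.
Qed.

(** The pointwise limit of the iterates is first shown to be Lipschitz, by passing to the limit in a
    bound common to the iterates; only then is A x known to be integrable, and the integral equation
    can be compared with that of the iterates. *)
Lemma trajectory_exists (R : realType) d (A : R -> 'M[R]_d) K x0 :
  bounded_law A K -> exists x, trajectory A x0 x.
Proof.
move=> bA; have [K0 AK mA] := bA.
have split3 (a b c e : 'cV[R]_d) : a - e = (a - b) + (b - c) - (e - c).
  by rewrite addrA subrK opprB addrA subrK.
have arith (p q : R) : 0 <= q -> q + p + q <= 4 * q + p by lra.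
pose y := picard A x0; pose b t := `|x0| * expR (2 * K * t).
have ly n : locally_lipschitz (y n) by exact: picard_lipschitz bA.
have b0 t : 0 <= b t by rewrite mulr_ge0 ?expR_ge0.
have bhom s t : s <= t -> b s <= b t.
  by move=> st; rewrite ler_wpM2l// ler_expR ler_wpM2l// mulr_ge0// ltW.
have /choice[x Hx] : forall t, exists v : 'cV[R]_d, 0 <= t ->
    forall n, `|v - y n t| <= 2 * b t / 2 ^+ n.
  move=> t; have [t0|] := leP 0 t; last by exists 0.
  have /choice[l Hl] : forall i, exists l, forall n, `|l - y n t i 0| <= 2 * b t / 2 ^+ n.
    move=> i; apply: geometric_limit => n.
    have := picard_step x0 n bA t0; rewrite /b mulrAC => /(le_trans _); apply.
    by have := normmx_ge (y n.+1 t - y n t) i 0; rewrite !mxE.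
  exists (\col_i l i) => _ n; apply: normmx_le => [|i j].
    by rewrite !mulr_ge0 ?invr_ge0 ?exprn_ge0.
  by rewrite !mxE ord1.
have lx : locally_lipschitz x.
  (* Both x0, the iterate of index 0, and every other iterate lie within 2 b T of the limit, so 2 B
     bounds all iterates on [0, T]. *)
  move=> T; pose B := `|x0| + 2 * b T.
  have B0 : 0 <= B by rewrite addr_ge0 ?mulr_ge0.
  have geo t n : 0 <= t -> t <= T -> `|x t - y n t| <= 2 * b T / 2 ^+ n.
    move=> t0 tT; apply: le_trans (Hx _ t0 n) _.
    by rewrite ler_wpM2r ?invr_ge0 ?exprn_ge0// ler_wpM2l// bhom.
  have yB n u : 0 <= u -> u <= T -> `|y n u| <= 2 * B.
    move=> u0 uT; have h0 := geo u 0%N u0 uT; rewrite expr0 divr1 in h0.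
    have h1 : `|x u - y n u| <= 2 * b T.
      apply: le_trans (geo u n u0 uT) _; rewrite ler_piMr ?mulr_ge0//.
      by rewrite invf_le1 ?exprn_gt0// exprn_ege1// ler1n.
    have -> : y n u = x0 + (x u - y 0%N u) - (x u - y n u).
      by apply/colP => i; rewrite /y /= !mxE; ring.
    apply: le_trans (ler_normB _ _) _; have := ler_normD x0 (x u - y 0%N u).
    rewrite /B; have := normr_ge0 x0; lra.
  exists (K * (2 * B)) => [|s t s0 st tT]; first by rewrite !mulr_ge0// ltW.
  have t0 := le_trans s0 st; have sT := le_trans st tT.
  rewrite -subr_le0; apply: (@le0_geometric _ _ (4 * b T)) => n.
  have hy : `|y n.+1 t - y n.+1 s| <= K * (2 * B) * (t - s).
    apply: normmx_le => [|i j]; first by rewrite !mulr_ge0 ?subr_ge0// ltW.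
    rewrite /y /= !mxE opprD addrACA subrr add0r mulrC.
    apply: primitive_le => // [|u su ut].
      by apply: (law_field_integrable _ bA); exact: locally_lipschitz_continuous.
    have u0 : 0 <= u by rewrite (le_trans s0)// ltW.
    apply: le_trans (normmx_ge _ _ _) _; apply: le_trans (AK _ u0 _) _.
    by rewrite ler_wpM2l ?(ltW K0)// yB// (le_trans (ltW ut)).
  rewrite (split3 _ (y n.+1 t) (y n.+1 s)).
  have := geo t n.+1 t0 tT; have := geo s n.+1 s0 sT.
  have -> : 2 * b T / 2 ^+ n.+1 = b T / 2 ^+ n.
    by rewrite exprS; field; rewrite expf_neq0.
  move=> h1 h2; rewrite lerBlDr; apply: le_trans (ler_normB _ _) _.
  apply: le_trans (lerD (ler_normD _ _) (lexx _)) _.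
  apply: le_trans (lerD (lerD h2 hy) h1) _.
  have -> : 4 * b T / 2 ^+ n = 4 * (b T / 2 ^+ n) by rewrite mulrA.
  have : 0 <= b T / 2 ^+ n by rewrite divr_ge0// exprn_ge0.
  exact: arith.
exists x; split=> [|t t0 i]; first exact: locally_lipschitz_continuous.
rewrite -/(primitive (fun s => (A s *m x s) i 0) t).
apply/eqP; rewrite -subr_eq0 -normr_le0.
apply: (@le0_geometric _ _ (2 * b t + t * (K * (2 * b t)))) => n.
have h1 : `|x t i 0 - y n.+1 t i 0| <= 2 * b t / 2 ^+ n.
  have := normmx_ge (x t - y n.+1 t) i 0; rewrite !mxE => /le_trans; apply.
  apply: le_trans (Hx _ t0 _) _; rewrite ler_wpM2l ?mulr_ge0//.
  by rewrite lef_pV2 ?posrE ?exprn_gt0// exprS ler_peMl ?exprn_ge0// ler1n.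
have h2 : `|y n.+1 t i 0 - (x0 i 0 + primitive (fun s => (A s *m x s) i 0) t)| <=
    t * (K * (2 * b t)) / 2 ^+ n.
  rewrite /y /= mxE opprD addrACA subrr add0r (primitive_field_sub i t bA (ly n) lx).
  have lf : locally_integrable (fun s => (A s *m (y n s - x s)) i 0).
    apply: (law_field_integrable _ bA); apply: locally_lipschitz_continuous.
    exact: locally_lipschitzB (ly n) lx.
  have -> : t * (K * (2 * b t)) / 2 ^+ n = (t - 0) * (K * (2 * b t / 2 ^+ n)).
    by rewrite subr0 !mulrA.
  rewrite -[X in `|X|]subr0 -[X in `|_ - X|](primitive0 lf).
  apply: primitive_le => // u u0 ut.
  apply: le_trans (normmx_ge _ _ _) _; apply: le_trans (AK _ (ltW u0) _) _.
  rewrite ler_wpM2l ?(ltW K0)// distrC; apply: le_trans (Hx _ (ltW u0) n) _.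
  by rewrite ler_wpM2r ?invr_ge0 ?exprn_ge0// ler_wpM2l// bhom// ltW.
rewrite mulrDl -[X in `|X|](_ : (x t i 0 - y n.+1 t i 0) + (y n.+1 t i 0 -
  (x0 i 0 + primitive (fun s => (A s *m x s) i 0) t)) = _); last by rewrite addrA subrK.
by apply: le_trans (ler_normD _ _) _; exact: lerD.
Qed.

(** * Invariant forms and growth rates *)

Lemma compact_family_bound (R : realType) d (F : set 'M[R]_d) : compact F ->
  exists2 K, 0 < K & forall M, F M -> forall v : 'cV[R]_d, `|M *m v| <= K * `|v|.
Proof.
move=> /compact_bounded[B [_ HB]].
have B1 : 0 <= `|B| + 1 by rewrite addr_ge0.
exists (d%:R * (`|B| + 1) + 1) => [|M FM v]; first by rewrite ltr_wpDl// mulr_ge0.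
apply: le_trans (normmx_mul _ _) _; rewrite ler_wpM2r// ler_wpDr// ler_wpM2l//.
by apply: HB FM; rewrite (le_lt_trans (ler_norm B))// ltrDl.
Qed.

Lemma switching_law_bounded (R : realType) d (F : set 'M[R]_d) K A :
  0 < K -> (forall M, F M -> forall v : 'cV[R]_d, `|M *m v| <= K * `|v|) ->
  switching_law F A -> bounded_law A K.
Proof. by move=> K0 HK [FA mA]; split=> // t t0; exact/HK/FA. Qed.

Lemma bilinear_bound (R : realType) d (Q : 'M[R]_d) : exists2 c : R, 0 <= c &
  forall a b : 'cV[R]_d, `|(a^T *m Q *m b) 0 0| <= c * (`|a| * `|b|).
Proof.
exists (d%:R * (d%:R * `|Q|)) => [|a b]; first by rewrite !mulr_ge0.
rewrite -mulmxA mxE; apply: le_trans (ler_norm_sum _ _ _) _.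
apply: le_trans (_ : \sum_(i < d) (d%:R * `|Q| * (`|a| * `|b|)) <= _); last first.
  by rewrite sumr_const card_ord -[X in X <= _]mulr_natl !mulrA.
apply: ler_sum => i _; rewrite mxE normrM mulrCA.
rewrite ler_pM// ?normmx_ge//.
by apply: le_trans (normmx_ge _ _ _) _; exact: normmx_mul.
Qed.

(** By symmetry of Q the two terms of v^T (M^T Q + Q M) v are equal, and their sum is 0. *)
Lemma infinitesimal_isometry (R : realType) d (Q M : 'M[R]_d) (v : 'cV[R]_d) :
  Q^T = Q -> M^T *m Q + Q *m M = 0 -> ((M *m v)^T *m Q *m v) 0 0 = 0.
Proof.
move=> Qs H; set r := _ 0 0.
have e1 : r = (v^T *m (M^T *m Q) *m v) 0 0 by rewrite /r trmx_mul !mulmxA.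
have e2 : r = (v^T *m (Q *m M) *m v) 0 0.
  have -> : r = (((M *m v)^T *m Q *m v)^T) 0 0 by rewrite [in RHS]mxE.
  by rewrite !trmx_mul !trmxK Qs !mulmxA.
have : (v^T *m (M^T *m Q + Q *m M) *m v) 0 0 = r + r.
  by rewrite mulmxDr mulmxDl mxE -e1 -e2.
rewrite H mulmx0 mul0mx mxE; lra.
Qed.

(* With q x = x^T Q x, the increment q (x t) - q (x s) is the integral over
   [s, t] of (A x)^T Q (x t + x s); as (A x)^T Q x = 0, this is quadratic in
   t - s. *)
Lemma quadratic_form_constant (R : realType) d (Q : 'M[R]_d) A K x0 x t :
  bounded_law A K -> trajectory A x0 x -> Q^T = Q ->
  (forall t, 0 <= t -> (A t)^T *m Q + Q *m A t = 0) -> 0 <= t ->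
  ((x t)^T *m Q *m x t) 0 0 = ((x 0)^T *m Q *m x 0) 0 0.
Proof.
move=> bA tx Qs HA t0; have [K0 AK mA] := bA; have [cx xE] := tx.
have lx := trajectory_lipschitz bA tx.
have [M M0 HM] := continuous_bounded t cx.
have [C C0 HC] := lx t; have [c c0 Hc] := bilinear_bound Q.
have lf i := law_field_integrable i bA cx.
apply: (@quad_incr_eq _ (fun t => ((x t)^T *m Q *m x t) 0 0) 0 t
  (c * (K * M) * (2 * C))) => // u v u0 uv vt.
have v0 := le_trans u0 uv; have ut := le_trans uv vt.
pose p := Q *m (x v + x u).
have -> : ((x v)^T *m Q *m x v) 0 0 - ((x u)^T *m Q *m x u) 0 0 =
    ((x v - x u)^T *m p) 0 0.
  have -> : (x v - x u)^T = (x v)^T - (x u)^T by rewrite linearB.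
  rewrite /p mulmxA !mulmxBl !mulmxDr.
  have -> : (x v)^T *m Q *m x u = ((x u)^T *m Q *m x v)^T.
    by rewrite !trmx_mul !trmxK Qs mulmxA.
  by rewrite !mxE; ring.
have -> : ((x v - x u)^T *m p) 0 0 =
    primitive (fun s => \sum_i p i 0 * (A s *m x s) i 0) v -
    primitive (fun s => \sum_i p i 0 * (A s *m x s) i 0) u.
  rewrite !primitive_sum// -sumrB mxE; apply: eq_bigr => i _.
  rewrite !mxE (xE v v0 i) (xE u u0 i) -mulrBr mulrC; congr (_ * _).
  by rewrite opprD addrACA subrr add0r.
have lip s : 0 <= s -> s <= t -> `|x s| <= M by exact: HM.
apply: (le_trans (primitive_le (M := c * (K * M) * (2 * C) * (v - u)) _ u0 uv _)).
- exact: locally_integrable_sum.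
- move=> s /ltW us /ltW sv; have s0 := le_trans u0 us; have st := le_trans sv vt.
  (* Subtracting 2 x s from x v + x u changes nothing, as x s is orthogonal to A s x s for Q, and
     leaves a vector of size O(v - u). *)
  have -> : \sum_i p i 0 * (A s *m x s) i 0 =
      ((A s *m x s)^T *m Q *m ((x v - x s) - (x s - x u))) 0 0.
    rewrite (_ : x v - x s - (x s - x u) = (x v + x u) - (x s + x s)); last first.
      by apply/colP => i; rewrite !mxE; ring.
    have z : (A s *m x s)^T *m Q *m x s = 0.
      by apply/matrixP => i j; rewrite !ord1 infinitesimal_isometry ?HA// mxE.
    rewrite mulmxBr (mulmxDr _ (x s)) z addr0 subr0 -mulmxA -/p mxE.
    by apply: eq_bigr => i _; rewrite [in RHS]mxE mulrC.
  have -> : c * (K * M) * (2 * C) * (v - u) = c * ((K * M) * ((2 * C) * (v - u))).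
    by rewrite !mulrA.
  apply: le_trans (Hc _ _) _; rewrite ler_wpM2l// ler_pM//.
    by apply: le_trans (AK _ s0 _) _; rewrite ler_wpM2l ?lip// ltW.
  apply: le_trans (ler_normB _ _) _.
  have := HC s v s0 sv vt; have := HC u s u0 us st.
  have : C * (v - s) <= C * (v - u) by rewrite ler_wpM2l// lerD2l lerN2.
  have : C * (s - u) <= C * (v - u) by rewrite ler_wpM2l// lerD2r.
  move: (`|_|) (`|_|) => n1 n2; lra.
- by rewrite [X in X <= _](_ : _ = c * (K * M) * (2 * C) * (v - u) ^+ 2)//; ring.
Qed.

Lemma growth_rate_le (R : realType) d (x : R -> 'cV[R]_d) (a C T : R) : 0 < C ->
  (forall t, T <= t -> `|x t| <= C * expR (a * t)) -> (growth_rate x <= a%:E)%E.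
Proof.
move=> C0 H; apply/lee_addgt0Pr => e e0.
(* Beyond ln C / e the constant C adds at most e to the exponent; the 1 makes t positive. *)
pose M := Num.max (Num.max T 1) (ln C / e).
apply: (@le_trans _ _ (ereal_sup [set (t^-1%:E * lne `|x t|%:E)%E | t in [set t | M < t]])).
  apply: ereal_inf_lbound; exists [set t | M < t] => //.
  by exists M; split; first exact: num_real.
apply: ge_ereal_sup => _ [t /= Mt <-].
have /andP[/andP[Tt t1] Ct] : (T < t) && (1 < t) && (ln C / e < t) by rewrite -!gt_max.
have t0 : 0 < t by rewrite (lt_trans _ t1).
rewrite -EFinD /lne; case: ifPn => [_|].
  by rewrite mulrNy gtr0_sg ?invr_gt0// mul1e leNye.
rewrite -ltNge => x0; rewrite -EFinM lee_fin mulrC ler_pdivrMr//.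
apply: (@le_trans _ _ (ln (C * expR (a * t)))).
  by rewrite ler_ln ?posrE ?mulr_gt0 ?expR_gt0// H// ltW.
rewrite lnM ?posrE ?expR_gt0// expRK mulrDl addrC lerD2l.
by rewrite mulrC -ler_pdivrMr// ltW.
Qed.

(** An upper limit is bounded below by values at arbitrarily large times, so a step law need be
    examined at its switching times only. *)
Lemma growth_rate_ge (R : realType) d (x : R -> 'cV[R]_d) (a c : R) : 0 < c ->
  (forall T, exists2 t, T <= t & c * expR (a * t) <= `|x t|) -> (a%:E <= growth_rate x)%E.
Proof.
move=> c0 H; apply/lee_subgt0Pr => e e0.
apply: le_ereal_inf_tmp => _ [V [M [_ HV]] <-].
have [t Mt xt] := H (Num.max (Num.max (M + 1) 1) (- ln c / e)).
have /andP[/andP[MM t1] ct] : (M + 1 <= t) && (1 <= t) && (- ln c / e <= t).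
  by rewrite -!ge_max.
have t0 : 0 < t by rewrite (lt_le_trans _ t1).
apply: le_trans (_ : (t^-1%:E * lne `|x t|%:E <= _)%E); last first.
  by apply: ereal_sup_ubound; exists t => //; apply: HV; rewrite (lt_le_trans _ MM)// ltrDl.
have ce0 : 0 < c * expR (a * t) by rewrite mulr_gt0 ?expR_gt0.
have x0 : 0 < `|x t| by rewrite (lt_le_trans _ xt).
rewrite /lne ifF ?(lt_geF x0)// -EFinM -EFinB lee_fin mulrC ler_pdivlMr//.
apply: (@le_trans _ _ (ln (c * expR (a * t)))); last by rewrite ler_ln.
rewrite lnM ?posrE ?expR_gt0// expRK mulrBl addrC lerD2r lerNl.
by rewrite [e * t]mulrC -ler_pdivrMr.
Qed.

(** * Flows of constant matrices *)

(* The equation y' = M y in a form that involves neither derivatives nor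
   integrals. *)
Definition flow_on (R : realType) d (M : 'M[R]_d) (a b : R) (y : R -> 'cV[R]_d) : Prop :=
  exists C, forall s t, a <= s -> s <= t -> t <= b ->
    `|y t - y s - (t - s) *: (M *m y s)| <= C * (t - s) ^+ 2.

Lemma flow_on_le (R : realType) d (M : 'M[R]_d) K a b y : 0 <= K ->
  (forall v : 'cV[R]_d, `|M *m v| <= K * `|v|) -> a <= b -> flow_on M a b y ->
  `|y b| <= expR (K * (b - a)) * `|y a|.
Proof.
move=> K0 MK ab [C HC].
apply: (@quad_gronwall _ (fun t => `|y t|) a b K C) => // s t a_s st tb.
have split2 (z p q : 'cV[R]_d) : z = (p + q) + (z - p - q).
  by apply/colP => i; rewrite !mxE; ring.
rewrite {1}(split2 (y t) (y s) ((t - s) *: (M *m y s))).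
apply: le_trans (ler_normD _ _) _; apply: lerD; last exact: HC.
apply: le_trans (ler_normD _ _) _; rewrite mulrDl mul1r lerD2l normrZ.
rewrite ger0_norm ?subr_ge0// [K * _]mulrC -mulrA ler_wpM2l// subr_ge0//.
Qed.

(** Gronwall with time reversed. A backward step divides by 1 - q with q = K (t - s); as q <= 1/2, 1
    / (1 - q) <= 1 + 2 q, whence the rate 2 K. This makes short flows invertible. *)
Lemma flow_on_ge (R : realType) d (M : 'M[R]_d) K a b y : 0 <= K ->
  (forall v : 'cV[R]_d, `|M *m v| <= K * `|v|) -> a <= b -> K * (b - a) <= 2^-1 ->
  flow_on M a b y -> `|y a| <= expR (2 * K * (b - a)) * `|y b|.
Proof.
move=> K0 MK ab Kab [C HC].
have K20 : 0 <= 2 * K by rewrite mulr_ge0.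
have arith (q n n' c : R) : 0 <= q -> q <= 2^-1 -> 0 <= n -> 0 <= n' -> 0 <= c ->
    n <= n' + q * n + c -> n <= (1 + 2 * q) * n' + 2 * c.
  move=> q0 q1 n0 n0' c0 H; have H1 : (1 - q) * n <= n' + c by lra.
  have H2 : (1 + 2 * q) * ((1 - q) * n) <= (1 + 2 * q) * (n' + c) by rewrite ler_wpM2l//; lra.
  have H3 : 0 <= q * (1 - 2 * q) * n by rewrite !mulr_ge0//; lra.
  have H4 : 0 <= (1 - 2 * q) * c by rewrite mulr_ge0//; lra.
  nra.
have := @quad_gronwall _ (fun t => `|y (a + b - t)|) a b (2 * K) (2 * `|C|) ab K20.
rewrite [a + b - a]addrAC subrr add0r addrK; apply=> // s t a_s st tb.
have h : a + b - s - (a + b - t) = t - s by ring.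
have h1 : a <= a + b - t by rewrite -addrA lerDl subr_ge0.
have h2 : a + b - t <= a + b - s by rewrite lerD2l lerN2.
have h3 : a + b - s <= b by rewrite addrAC gerDr subr_le0.
have := HC _ _ h1 h2 h3; rewrite h.
move: (y (a + b - s)) (y (a + b - t)) => z z' H.
have ts0 : 0 <= t - s by rewrite subr_ge0.
have := arith (K * (t - s)) `|z'| `|z| (`|C| * (t - s) ^+ 2).
rewrite [2 * (K * _)]mulrA [2 * (`|C| * _)]mulrA; apply=> //.
- by rewrite mulr_ge0.
- by apply: le_trans Kab; rewrite ler_wpM2l// lerB.
- by rewrite mulr_ge0 ?sqr_ge0.
have split2 (p q r : 'cV[R]_d) : p = q - r - (q - p - r).
  by apply/colP => i; rewrite !mxE; ring.
rewrite {1}(split2 z' z ((t - s) *: (M *m z'))).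
apply: le_trans (ler_normB _ _) _; apply: lerD; last first.
  by apply: (le_trans H); rewrite ler_wpM2r ?sqr_ge0// ler_norm.
apply: le_trans (ler_normB _ _) _; rewrite lerD2l normrZ ger0_norm// mulrC mulrAC ler_wpM2r//.
Qed.

Lemma flow_on_lin (R : realType) d (M : 'M[R]_d) a b c y z :
  flow_on M a b y -> flow_on M a b z -> flow_on M a b (fun t => c *: y t + z t).
Proof.
move=> [C HC] [D HD]; exists (`|c| * C + D) => s t a_s st tb.
have -> : c *: y t + z t - (c *: y s + z s) - (t - s) *: (M *m (c *: y s + z s)) =
    c *: (y t - y s - (t - s) *: (M *m y s)) + (z t - z s - (t - s) *: (M *m z s)).
  rewrite mulmxDr -scalemxAr; move: (M *m y s) (M *m z s) => p q.
  by apply/colP => i; rewrite !mxE; ring.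
apply: le_trans (ler_normD _ _) _; rewrite normrZ mulrDl -mulrA.
by apply: lerD; [rewrite ler_wpM2l ?HC|exact: HD].
Qed.

Lemma flow_on_sum (R : realType) d (M : 'M[R]_d) a b (I : Type) (r : seq I) (c : I -> R)
    (y : I -> R -> 'cV[R]_d) : (forall i, flow_on M a b (y i)) ->
  flow_on M a b (fun t => \sum_(i <- r) c i *: y i t).
Proof.
move=> H; elim: r => [|i r IH].
  under eq_fun do rewrite big_nil.
  by exists 0 => s t *; rewrite mulmx0 scaler0 !subr0 normr0 mul0r.
under eq_fun do rewrite big_cons.
exact: flow_on_lin.
Qed.

Lemma flow_on_shift (R : realType) d (M : 'M[R]_d) a b c y :
  flow_on M (a + c) (b + c) y -> flow_on M a b (fun t => y (t + c)).
Proof.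
move=> [C HC]; exists C => s t a_s st tb.
have := HC (s + c) (t + c); have -> : t + c - (s + c) = t - s by ring.
by rewrite !lerD2r; exact.
Qed.

Lemma flow_onS (R : realType) d (M : 'M[R]_d) a b a' b' y : a <= a' -> b' <= b ->
  flow_on M a b y -> flow_on M a' b' y.
Proof.
move=> aa bb [C HC]; exists C => s t h1 h2 h3.
by apply: HC => //; [exact: le_trans h1|exact: le_trans bb].
Qed.

Lemma trajectory_flow_on (R : realType) d (A : R -> 'M[R]_d) K x0 x M a b :
  bounded_law A K -> trajectory A x0 x -> 0 <= a ->
  (forall u, a < u -> u < b -> A u = M) -> flow_on M a b x.
Proof.
move=> bA tx a0 AM; have [cx xE] := tx; have [K0 AK mA] := bA.
have [C C0 HC] := trajectory_lipschitz bA tx b.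
exists (d%:R * `|M| * C) => s t a_s st tb.
have s0 := le_trans a0 a_s; have t0 := le_trans s0 st.
apply: normmx_le => [|i j]; first by rewrite mulr_ge0 ?sqr_ge0// !mulr_ge0.
have coord (p q r : 'cV[R]_d) (c : R) :
    (p - q - c *: r) i 0 = p i 0 - q i 0 - c * r i 0 by rewrite !mxE.
rewrite ord1 coord (xE t t0 i) (xE s s0 i).
rewrite opprD addrACA subrr add0r.
have [mf bf] := law_field_integrable i bA cx.
have -> : d%:R * `|M| * C * (t - s) ^+ 2 = (t - s) * (d%:R * `|M| * (C * (t - s))) by ring.
apply: (primitive_incr mf bf s0 st) => u su ut.
rewrite AM; last 2 first.
- exact: le_lt_trans su.
- exact: lt_le_trans tb.
rewrite -[X in `|X|](_ : (M *m (x u - x s)) i 0 = _); last by rewrite mulmxBr !mxE.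
apply: le_trans (normmx_ge _ _ _) _; apply: le_trans (normmx_mul _ _) _.
rewrite ler_wpM2l ?mulr_ge0//; apply: le_trans (HC _ _ s0 (ltW su) _) _.
  by rewrite (le_trans (ltW ut)).
by rewrite ler_wpM2l// lerB// ltW.
Qed.

(** The trajectory of the constant law takes the place of the exponential series. *)
Lemma constant_flow (R : realType) d (M : 'M[R]_d) (v : 'cV[R]_d) :
  exists2 y, y 0 = v & forall b, flow_on M 0 b y.
Proof.
have bM : bounded_law (fun=> M) (d%:R * `|M| + 1).
  split=> [|t _ w|i j]; first by rewrite ltr_wpDl// mulr_ge0.
    by apply: le_trans (normmx_mul _ _) _; rewrite ler_wpM2r// lerDl.
  exact: measurable_cst.
have [x tx] := trajectory_exists v bM; exists x => [|b]; last exact: (trajectory_flow_on bM tx).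
have [cx xE] := tx; apply/colP => i; rewrite (xE 0 (lexx _) i).
rewrite -[X in _ + X]/(primitive _ 0) primitive0 ?addr0//.
exact: law_field_integrable bM cx.
Qed.

(** Quantifying over the starting time [a] builds in autonomy: the same E serves for every cell of a
    step law. *)
Definition is_flow (R : realType) d (M : 'M[R]_d) (tau : R) (E : 'M[R]_d) : Prop :=
  forall a y, flow_on M a (a + tau) y -> y (a + tau) = E *m y a.

(** The columns of E are the values at tau of the solutions from the basis vectors. A solution minus
    the matching combination of these starts at 0, and [flow_on_le] keeps it there. *)
Lemma flow_exists (R : realType) d (M : 'M[R]_d) tau : 0 <= tau -> exists E, is_flow M tau E.
Proof.
move=> tau0; have /choice[y Hy] : forall j : 'I_d, exists y : R -> 'cV[R]_d,
    y 0 = delta_mx j 0 /\ forall b, flow_on M 0 b y.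
  by move=> j; have [y] := constant_flow M (delta_mx j 0); exists y.
exists (\matrix_(i, j) y j tau i 0) => a z Hz.
pose u t := - 1 *: (\sum_j z a j 0 *: y j t) + z (t + a).
have Hu : flow_on M 0 tau u.
  apply: flow_on_lin; first by apply: flow_on_sum => i; exact: (Hy i).2.
  by apply: flow_on_shift; rewrite add0r addrC.
have u0 : u 0 = 0.
  rewrite /u add0r [X in _ *: X](_ : _ = z a) ?scaleN1r ?addNr//.
  rewrite [RHS](matrix_sum_delta (z a)); apply: eq_bigr => j _.
  by rewrite big_ord1 (Hy j).1.
have MK (v : 'cV[R]_d) : `|M *m v| <= d%:R * `|M| * `|v| by exact: normmx_mul.
have := flow_on_le _ MK tau0 Hu; rewrite u0 normr0 mulr0 mulr_ge0// => /(_ isT).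
rewrite normr_le0 /u scaleN1r addrC subr_eq0 addrC => /eqP ->.
apply/colP => i; rewrite summxE mxE; apply: eq_bigr => j _.
by rewrite !mxE mulrC.
Qed.

(* exp(tau M) *)
Definition flow (R : realType) d (M : 'M[R]_d) (tau : R) : 'M[R]_d :=
  xget 0 [set E | is_flow M tau E].

Lemma flowP (R : realType) d (M : 'M[R]_d) tau : 0 <= tau -> is_flow M tau (flow M tau).
Proof.
move=> tau0; have [E HE] := flow_exists M tau0.
exact: (xgetPex 0 (ex_intro [set E | is_flow M tau E] E HE)).
Qed.

Lemma flow0E (R : realType) d (M : 'M[R]_d) tau y : 0 <= tau -> flow_on M 0 tau y ->
  y tau = flow M tau *m y 0.
Proof. by move=> t0; have := @flowP _ _ M tau t0 0 y; rewrite add0r. Qed.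

Lemma flow_le (R : realType) d (M : 'M[R]_d) K tau (v : 'cV[R]_d) : 0 <= K ->
  (forall v : 'cV[R]_d, `|M *m v| <= K * `|v|) -> 0 <= tau ->
  `|flow M tau *m v| <= expR (K * tau) * `|v|.
Proof.
move=> K0 MK t0; have [y y0 Hy] := constant_flow M v.
by rewrite -y0 -(flow0E t0 (Hy _)) -{2}[tau]subr0; exact: flow_on_le.
Qed.

Lemma flow_ge (R : realType) d (M : 'M[R]_d) K tau (v : 'cV[R]_d) : 0 <= K ->
  (forall v : 'cV[R]_d, `|M *m v| <= K * `|v|) -> 0 <= tau -> K * tau <= 2^-1 ->
  `|v| <= expR (2 * K * tau) * `|flow M tau *m v|.
Proof.
move=> K0 MK t0 Kt; have [y y0 Hy] := constant_flow M v.
rewrite -y0 -(flow0E t0 (Hy _)) -{1}[tau]subr0; apply: flow_on_ge => //.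
by rewrite subr0.
Qed.

Lemma mulmx_ext (R : realType) m d (A B : 'M[R]_(m, d)) :
  (forall v : 'cV[R]_d, A *m v = B *m v) -> A = B.
Proof.
move=> H; apply/matrixP => i j.
have := congr1 (fun v : 'cV[R]_m => v i 0) (H (delta_mx j 0)).
by rewrite /= -!colE !mxE.
Qed.

Lemma flow_half (R : realType) d (M : 'M[R]_d) tau : 0 <= tau ->
  flow M tau = flow M (tau / 2) *m flow M (tau / 2).
Proof.
move=> t0; apply: mulmx_ext => v; have [y y0 Hy] := constant_flow M v.
have h0 : 0 <= tau / 2 by rewrite divr_ge0.
have e : tau / 2 + tau / 2 = tau by field.
rewrite -mulmxA -y0 -(flow0E t0 (Hy _)) -(flow0E h0 (Hy _)).
rewrite -{1}e; apply: flowP => //; rewrite e.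
by apply: flow_onS (Hy tau).
Qed.

Lemma flow_expand (R : realType) d (M : 'M[R]_d) (v : 'cV[R]_d) : exists C, forall tau,
  0 <= tau -> tau <= 1 -> `|flow M tau *m v - v - tau *: (M *m v)| <= C * tau ^+ 2.
Proof.
have [y y0 Hy] := constant_flow M v; have [C HC] := Hy 1.
exists C => tau t0 t1; have := HC 0 tau (lexx _) t0 t1.
by rewrite (flow0E t0 (Hy _)) y0 subr0.
Qed.

(** * Piecewise constant switching laws *)

Lemma trajectory_le (R : realType) d (A : R -> 'M[R]_d) K x0 x s t :
  bounded_law A K -> trajectory A x0 x -> 0 <= s -> s <= t ->
  `|x t| <= expR (K * (t - s)) * `|x s|.
Proof.
move=> bA tx s0 st; have [K0 AK mA] := bA; have [cx xE] := tx.
have [C C0 HC] := trajectory_lipschitz bA tx t.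
apply: (@quad_gronwall _ (fun t => `|x t|) s t K (K * C)) => //; first exact: ltW.
move=> u v su uv vt; have u0 := le_trans s0 su; have v0 := le_trans u0 uv.
rewrite -{1}[x v](subrK (x u)) addrC; apply: le_trans (ler_normD _ _) _.
rewrite mulrDl mul1r -addrA lerD2l.
have -> : K * (v - u) * `|x u| + K * C * (v - u) ^+ 2 =
    (v - u) * (K * (`|x u| + C * (v - u))) by ring.
apply: normmx_le => [|i j].
  by rewrite mulr_ge0 ?subr_ge0// mulr_ge0 ?(ltW K0)// addr_ge0// mulr_ge0// subr_ge0.
rewrite ord1 !mxE (xE v v0 i) (xE u u0 i) opprD addrACA subrr add0r.
apply: (primitive_le (law_field_integrable i bA cx) u0 uv) => r /ltW ur /ltW rv.
have r0 := le_trans u0 ur.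
apply: le_trans (normmx_ge _ _ _) _; apply: le_trans (AK _ r0 _) _.
rewrite ler_wpM2l ?(ltW K0)// -{1}[x r](subrK (x u)) addrC.
apply: le_trans (ler_normD _ _) _; rewrite lerD2l.
apply: le_trans (HC _ _ u0 ur _) _; first exact: le_trans vt.
by rewrite ler_wpM2l// lerD2r.
Qed.

Definition step_law (R : realType) d (w : nat -> 'M[R]_d) (delta t : R) : 'M[R]_d :=
  w (Num.truncn (t / delta)).

Lemma step_law_cell (R : realType) d (w : nat -> 'M[R]_d) (delta t : R) n : 0 < delta ->
  n%:R * delta <= t -> t < n.+1%:R * delta -> step_law w delta t = w n.
Proof.
move=> d0 nt tn; rewrite /step_law (@truncn_def _ _ n)//.
by rewrite ler_pdivlMr// nt ltr_pdivrMr.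
Qed.

Lemma step_law_switching (R : realType) d (F : set 'M[R]_d) (w : nat -> 'M[R]_d) delta :
  0 < delta -> (forall n, F (w n)) -> switching_law F (step_law w delta).
Proof.
move=> d0 Fw; split=> [t _|i j]; first exact: Fw.
move=> mD Y mY.
have -> : `[0, +oo[%classic `&` (fun t => step_law w delta t i j) @^-1` Y =
    \bigcup_n (if `[< Y (w n i j) >] then `[n%:R * delta, n.+1%:R * delta[%classic else set0).
  apply/seteqP; split=> t /=.
    rewrite in_itv/= andbT => -[t0 tY]; exists (Num.truncn (t / delta)) => //.
    rewrite ifT; last exact/asboolP.
    have : 0 <= t / delta by rewrite divr_ge0// ltW.
    by move=> /truncn_itv; rewrite ler_pdivlMr// ltr_pdivrMr// => h; rewrite /= in_itv.
  move=> [n _]; case: ifPn => // /asboolP Yn; rewrite /= in_itv/= => /andP[nt tn].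
  rewrite (step_law_cell _ d0 nt tn) in_itv/= andbT; split=> //.
  by rewrite (le_trans _ nt)// mulr_ge0// ltW.
apply: bigcupT_measurable => n; case: ifP => _ //.
exact: completed_measurable.
Qed.

Lemma step_law_trajectory (R : realType) d (w : nat -> 'M[R]_d) delta K x0 x n :
  0 < delta -> bounded_law (step_law w delta) K -> trajectory (step_law w delta) x0 x ->
  x (n.+1%:R * delta) = flow (w n) delta *m x (n%:R * delta).
Proof.
move=> d0 bA tx; have nd0 : 0 <= n%:R * delta by rewrite mulr_ge0// ltW.
have e : n.+1%:R * delta = n%:R * delta + delta by rewrite -natr1; ring.
rewrite e; apply: flowP; first exact: ltW.
apply: (trajectory_flow_on bA tx) => // u nu un; apply: step_law_cell => //.
  exact: ltW.
by rewrite e.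
Qed.

(** * Words and their concatenation *)

Fixpoint word_flow (R : realType) d (delta : R) (w : seq 'M[R]_d) : 'M[R]_d :=
  if w is a :: l then word_flow delta l *m flow a delta else 1%:M.

(** Words are played from left to right while matrices compose from right to left, hence the
    exchange. *)
Lemma word_flow_cat (R : realType) d (delta : R) (w1 w2 : seq 'M[R]_d) :
  word_flow delta (w1 ++ w2) = word_flow delta w2 *m word_flow delta w1.
Proof. by elim: w1 => [|a l IH] /=; rewrite ?mulmx1// IH mulmxA. Qed.

Definition word_in (R : realType) d (F : set 'M[R]_d) (w : seq 'M[R]_d) : Prop :=
  forall a, a \in w -> F a.

Lemma word_flow_le (R : realType) d (F : set 'M[R]_d) K delta w (v : 'cV[R]_d) : 0 < K ->
  (forall M, F M -> forall v : 'cV[R]_d, `|M *m v| <= K * `|v|) -> 0 <= delta ->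
  word_in F w -> `|word_flow delta w *m v| <= expR (K * delta * (size w)%:R) * `|v|.
Proof.
move=> K0 HK d0; elim: w v => [|a l IH] v Fw /=.
  by rewrite mul1mx mulr0 expR0 mul1r.
rewrite -mulmxA; apply: le_trans (IH _ _) _.
  by move=> b bl; apply: Fw; rewrite inE bl orbT.
rewrite -natr1 mulrDr mulr1 expRD -[X in _ <= X]mulrA ler_wpM2l ?expR_ge0//.
by apply: flow_le => //; [exact: ltW|apply: HK; apply: Fw; rewrite inE eqxx].
Qed.

(* A state consists of the current vector and of the letters of the chosen word
   that remain to be played; once they are exhausted, [c] chooses the next word. *)
Definition pending (R : realType) d (c : 'cV[R]_d -> seq 'M[R]_d)
    (s : 'cV[R]_d * seq 'M[R]_d) : seq 'M[R]_d :=
  if s.2 is [::] then c s.1 else s.2.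

Definition adaptive_state (R : realType) d (delta : R) (c : 'cV[R]_d -> seq 'M[R]_d)
    (x0 : 'cV[R]_d) (n : nat) : 'cV[R]_d * seq 'M[R]_d :=
  iter n (fun s => (flow (head 0 (pending c s)) delta *m s.1, behead (pending c s)))
    (x0, [::]).

(** When [c] doubles every nonzero vector, the default 0 is never played from a nonzero start: the
    empty word doubles no nonzero vector. *)
Definition adaptive_word (R : realType) d (delta : R) (c : 'cV[R]_d -> seq 'M[R]_d)
    (x0 : 'cV[R]_d) (n : nat) : 'M[R]_d :=
  head 0 (pending c (adaptive_state delta c x0 n)).

(* Playing a letter changes neither side of the main inequality; choosing a new
   word multiplies its right-hand side by 2 >= exp(a delta L). *)
Lemma adaptive_state_inv (R : realType) d (F : set 'M[R]_d) delta a L c (x0 : 'cV[R]_d) n :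
  0 <= a -> 0 < delta -> expR (a * delta * L%:R) <= 2 ->
  (forall x, x != 0 -> [/\ word_in F (c x), (size (c x) <= L)%N &
     2 * `|x| <= `|word_flow delta (c x) *m x|]) -> x0 != 0 ->
  let s := adaptive_state delta c x0 n in
  [/\ s.1 != 0, word_in F s.2, (size s.2 <= L)%N,
      expR (a * delta * (n + size s.2)%:R) * `|x0| <= `|word_flow delta s.2 *m s.1| &
      [/\ word_in F (pending c s), pending c s != [::], (size (pending c s) <= L)%N &
       expR (a * delta * (n + size (pending c s))%:R) * `|x0| <=
         `|word_flow delta (pending c s) *m s.1|]].
Proof.
move=> a0 d0 aL Hc x00.
have reload (x : 'cV[R]_d) (l : seq 'M[R]_d) m : x != 0 -> word_in F l -> (size l <= L)%N ->
    expR (a * delta * (m + size l)%:R) * `|x0| <= `|word_flow delta l *m x| ->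
    [/\ word_in F (pending c (x, l)), pending c (x, l) != [::],
      (size (pending c (x, l)) <= L)%N &
       expR (a * delta * (m + size (pending c (x, l)))%:R) * `|x0| <=
         `|word_flow delta (pending c (x, l)) *m x|].
  case: l => [|b l] x1 Fl lL H //=; rewrite /pending/=.
  have [Fc cL dbl] := Hc x x1; split=> //.
    apply/eqP => c0; move: dbl; rewrite c0 /= mul1mx.
    have : 0 < `|x| by rewrite normr_gt0.
    lra.
  apply: le_trans dbl; rewrite natrD mulrDr expRD.
  rewrite /= mul1mx addn0 in H.
  apply: le_trans (_ : 2 * (expR (a * delta * m%:R) * `|x0|) <= _); last first.
    by rewrite ler_wpM2l.
  rewrite mulrA ler_wpM2r// mulrC ler_wpM2r ?expR_ge0//; apply: le_trans aL.
  by rewrite ler_expR ler_wpM2l ?ler_nat// mulr_ge0// ltW.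
elim: n => [|n IH] s.
  have H0 : expR (a * delta * (0 + size (Nil 'M[R]_d))%:R) * `|x0| <=
      `|word_flow delta [::] *m x0| by rewrite /= mulr0 expR0 mul1mx mul1r.
  by split=> //; exact: reload.
have [_ _ _ _ [Fp p0 pL Hp]] := IH.
have E : s = (flow (head 0 (pending c (adaptive_state delta c x0 n))) delta *m
   (adaptive_state delta c x0 n).1, behead (pending c (adaptive_state delta c x0 n))) by [].
clearbody s; move: E Fp p0 pL Hp {IH}; move: (adaptive_state delta c x0 n) => s'.
case: (pending c s') => [|b l] //= E Fp _ lL Hp.
have H1 : expR (a * delta * (n.+1 + size l)%:R) * `|x0| <= `|word_flow delta l *m s.1|.
  by rewrite E /= mulmxA addSnnS.
have s10 : s.1 != 0.
  apply/eqP => s0; move: H1; rewrite s0 mulmx0 normr0 leNgt.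
  by rewrite mulr_gt0 ?expR_gt0 ?normr_gt0.
have Fl : word_in F l by move=> e el; apply: Fp; rewrite inE el orbT.
have lL' : (size l <= L)%N by exact: ltnW.
have Es : s = (s.1, l) by rewrite E.
have := reload s.1 l n.+1 s10 Fl lL' H1; rewrite -Es => H2.
have Es2 : s.2 = l by rewrite E.
by split; rewrite ?Es2.
Qed.

(** The common bound L on the lengths makes the exponent positive: a doubling is completed at least
    once in every time span delta L, whence a = ln 2 / (delta L). *)
Lemma doubling_growth (R : realType) d (F : set 'M[R]_d) K delta L (x0 : 'cV[R]_d) :
  0 < K -> (forall M, F M -> forall v : 'cV[R]_d, `|M *m v| <= K * `|v|) ->
  0 < delta -> x0 != 0 ->
  (forall x : 'cV[R]_d, x != 0 -> exists w, [/\ word_in F w, (size w <= L)%N &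
     2 * `|x| <= `|word_flow delta w *m x|]) ->
  exists A, switching_law F A /\ (0 < growth_exponent A)%E.
Proof.
move=> K0 HK d0 x00 dbl0.
have /choice[c Hc] : forall x : 'cV[R]_d, exists w, x != 0 -> [/\ word_in F w,
    (size w <= L)%N & 2 * `|x| <= `|word_flow delta w *m x|].
  move=> x; have [->|x1] := eqVneq x 0; first by exists [::].
  by have [w Hw] := dbl0 x x1; exists w.
have L0 : (0 < L)%N.
  have [_ cL dbl] := Hc _ x00; case: L cL dbl {Hc dbl0} => //.
  case: (c x0) => // _; rewrite /= mul1mx.
  have : 0 < `|x0| by rewrite normr_gt0.
  lra.
pose a := ln 2 / (delta * L%:R).
have ln20 : 0 < ln 2 :> R by rewrite ln_gt0// ltr1n.
have dL0 : 0 < delta * L%:R by rewrite mulr_gt0// ltr0n.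
have a0 : 0 < a by rewrite divr_gt0.
have aL : expR (a * delta * L%:R) <= 2.
  by rewrite -mulrA /a divfK ?gt_eqF// lnK// posrE.
have inv n := adaptive_state_inv n (ltW a0) d0 aL Hc x00.
pose w := adaptive_word delta c x0.
have Fw n : F (w n).
  have [_ _ _ _ [Fp p0 _ _]] := inv n; apply: Fp; rewrite /w /adaptive_word.
  by case: (pending c _) p0 => // b l _; rewrite inE eqxx.
have sA := step_law_switching d0 Fw.
exists (step_law w delta); split=> //.
have bA := switching_law_bounded K0 HK sA.
have [x tx] := trajectory_exists x0 bA.
have xn n : x (n%:R * delta) = (adaptive_state delta c x0 n).1.
  elim: n => [|n IH]; last by rewrite (step_law_trajectory n d0 bA tx) IH.
  have [cx xE] := tx; rewrite mul0r; apply/colP => i; rewrite (xE 0 (lexx _) i).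
  rewrite -[X in _ + X]/(primitive _ 0) primitive0 ?addr0//.
  exact: law_field_integrable bA cx.
apply: (@lt_le_trans _ _ a%:E); first by rewrite lte_fin.
apply: (@le_trans _ _ (growth_rate x)); last first.
  by apply: ereal_sup_ubound; exists x => //; exists x0.
(* The invariant bounds the vector after the remaining letters are played; these number at most L
   and expand by at most exp(K delta L), which is divided out here. *)
pose c1 := expR (- (K * delta * L%:R)) * `|x0|.
apply: (@growth_rate_ge _ _ _ _ c1); first by rewrite mulr_gt0 ?expR_gt0 ?normr_gt0.
move=> T; pose n := Num.truncn (T / delta); exists (n.+1%:R * delta).
  by rewrite -ler_pdivrMr// ltW// truncnS_gt.
rewrite xn; have [_ Fs sL Hs _] := inv n.+1.
move: Hs Fs sL; move: (adaptive_state _ _ _ _) => [y l] /= Hs Fs sL.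
have Hle := word_flow_le y K0 HK (ltW d0) Fs.
rewrite /c1 expRN -mulrA ler_pdivrMl ?expR_gt0//.
apply: (@le_trans _ _ (expR (K * delta * (size l)%:R) * `|y|)); last first.
  by rewrite ler_wpM2r// ler_expR ler_wpM2l ?ler_nat// mulr_ge0// ltW.
apply: le_trans Hle; apply: le_trans Hs; rewrite mulrC ler_wpM2r//.
rewrite ler_expR -mulrA ler_wpM2l ?(ltW a0)// mulrC ler_wpM2l ?(ltW d0)//.
by rewrite ler_nat leq_addr.
Qed.

(** The word is repeated periodically. It halves all vectors, so the rate ln 2 / D, with D the
    period, holds for every initial condition and survives the supremum. *)
Lemma contracting_decay (R : realType) d (F : set 'M[R]_d) K delta w :
  0 < K -> (forall M, F M -> forall v : 'cV[R]_d, `|M *m v| <= K * `|v|) ->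
  0 < delta -> word_in F w -> w != [::] ->
  (forall v : 'cV[R]_d, `|word_flow delta w *m v| <= 2^-1 * `|v|) ->
  exists A, switching_law F A /\ (growth_exponent A < 0)%E.
Proof.
move=> K0 HK d0 Fw w0 Hw; pose L := size w.
have L0 : (0 < L)%N by rewrite lt0n size_eq0.
pose W n := nth 0 w (n %% L).
have FW n : F (W n) by apply: Fw; rewrite mem_nth// ltn_mod.
have sA := step_law_switching d0 FW; exists (step_law W delta); split=> //.
have bA := switching_law_bounded K0 HK sA.
pose D := delta * L%:R; have D0 : 0 < D by rewrite mulr_gt0// ltr0n.
pose a := ln 2 / D; have ln20 : 0 < ln 2 :> R by rewrite ln_gt0// ltr1n.
have a0 : 0 < a by rewrite divr_gt0.
apply: (@le_lt_trans _ _ (- a)%:E); last by rewrite lte_fin oppr_lt0.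
apply: ge_ereal_sup => _ [x [x0 tx] <-].
pose y n := x (n%:R * delta).
have yS n : y n.+1 = flow (W n) delta *m y n by exact: step_law_trajectory bA tx.
have yL n i : (i <= L)%N -> y (n * L + i)%N = word_flow delta (take i w) *m y (n * L)%N.
  elim: i => [|i IH] iL; first by rewrite take0 addn0 mul1mx.
  rewrite addnS yS IH ?(ltnW iL)// mulmxA (take_nth 0 iL) -cats1 word_flow_cat/= mul1mx.
  by rewrite /W modnMDl modn_small.
have yn n : `|y (n * L)%N| <= `|y 0%N| / 2 ^+ n.
  elim: n => [|n IH]; first by rewrite mul0n expr0 divr1.
  rewrite mulSnr yL// take_size; apply: le_trans (Hw _) _.
  by rewrite exprS invfM mulrCA ler_wpM2l// invr_ge0.
(* exp(K D) covers the growth inside the unfinished period, the factor 2 the halving that this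
   period has not yet achieved, and + 1 keeps the constant positive for the zero trajectory. *)
apply: (@growth_rate_le _ _ _ _ (expR (K * D) * (2 * (`|y 0%N| + 1))) 0).
  by rewrite !mulr_gt0 ?expR_gt0// ltr_wpDl.
move=> t t0; pose n := Num.truncn (t / D).
have /truncn_itv : 0 <= t / D by rewrite divr_ge0// ltW.
rewrite -/n ler_pdivlMr// ltr_pdivrMr// => /andP[nt tn].
have e : n%:R * D = (n * L)%N%:R * delta by rewrite natrM /D; ring.
apply: le_trans (trajectory_le bA tx _ nt) _; first by rewrite mulr_ge0// ltW.
rewrite -[X in _ <= X]mulrA ler_pM ?expR_ge0//.
  rewrite ler_expR ler_wpM2l ?(ltW K0)// lerBlDr.
  by rewrite (le_trans (ltW tn))// -natr1 mulrDl mul1r addrC.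
rewrite e; apply: le_trans (yn n) _.
have h : (2 ^+ n)^-1 <= 2 * expR (- a * t) :> R.
  have -> : (2 ^+ n)^-1 = expR (- (n%:R * ln 2)) :> R.
    by rewrite expRN expRM_natl lnK// posrE.
  rewrite -[X in _ <= X * _](@lnK _ 2) ?posrE// -expRD ler_expR.
  have : t / D <= n%:R + 1 by rewrite ler_pdivrMr// natr1 ltW.
  rewrite /a mulNr mulrAC -mulrA => h1; have := ler_wpM2l (ltW ln20) h1.
  lra.
apply: (le_trans (ler_wpM2l (normr_ge0 _) h)).
rewrite mulrCA -mulrA ler_wpM2l// ler_wpM2r ?expR_ge0// lerDl//.
Qed.

(** * Bounded groups of matrices *)

Definition cluster_pt (R : realType) m n (u : nat -> 'M[R]_(m, n)) (p : 'M[R]_(m, n)) : Prop :=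
  forall e, 0 < e -> forall N, exists2 k, (N <= k)%N & `|u k - p| < e.

Lemma bounded_cluster_pt (R : realType) m n (u : nat -> 'M[R]_(m, n)) (B : R) :
  (forall k, `|u k| <= B) -> exists p, cluster_pt u p.
Proof.
move=> uB.
pose A : set 'rV[R]_(m * n) := [set v | forall i, `[- B, B]%classic (v ord0 i)].
have cA : compact A.
  by apply: (@rV_compact _ _ (fun=> `[- B, B]%classic)) => _; exact: segment_compact.
have [|p [_ clp]] := cA ((mxvec \o u) @ \oo) _.
  exists 0%N => // k _ i; rewrite /= in_itv/= -ler_norml.
  case/mxvec_indexP: i => i j; rewrite mxvecE; exact: le_trans (normmx_ge _ _ _) (uB k).
exists (vec_mx p) => e e0 N.
have e20 : 0 < e / 2 by rewrite divr_gt0.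
have [|v [[k Nk <-]]] := clp [set mxvec (u k) | k in [set k | (N <= k)%N]]
    (ball p (e / 2)) _ (nbhsx_ballx _ _ e20).
  by exists N => // k Nk; exists k.
rewrite -ball_normE /ball_ /= => pe; exists k => //.
apply: le_lt_trans (_ : e / 2 < e); last by rewrite ltr_pdivrMr// ltr_pMr// ltr1n.
apply: normmx_le => [|i j]; first exact: ltW.
have := normmx_ge (p - mxvec (u k)) 0 (mxvec_index i j).
rewrite [X in `|X| <= _]mxE [X in _ + X]mxE mxvecE => h.
rewrite [X in `|X|]mxE [X in _ + X]mxE distrC [X in `|X - _|]mxE.
exact: le_trans h (ltW pe).
Qed.

(** Stands in for continuity along a convergent subsequence: closed inequalities pass to a cluster
    point. *)
Lemma cluster_pt_le (R : realType) m n (u : nat -> 'M[R]_(m, n)) p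
    (f : 'M[R]_(m, n) -> R) (C b : R) : cluster_pt u p ->
  (forall A, `|f A - f p| <= C * `|A - p|) ->
  (forall e, 0 < e -> exists N, forall k, (N <= k)%N -> f (u k) <= b + e) -> f p <= b.
Proof.
move=> cl fC H; apply/ler_addgt0Pr => e e0.
have e20 : 0 < e / 2 by rewrite divr_gt0.
have C1 : 0 < `|C| + 1 by rewrite ltr_wpDl.
have [N HN] := H _ e20; have [k Nk ke] := cl (e / 2 / (`|C| + 1)) (divr_gt0 e20 C1) N.
have := fC (u k); rewrite ltr_pdivlMr// in ke.
have := HN k Nk; have := ler_norm C; have := normr_ge0 (u k - p).
rewrite ler_norml; move: (`|u k - p|) ke => x ke x0 Cn h1 /andP[h2 _].
have : C * x <= `|C| * x by rewrite ler_wpM2r.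
have : x * (`|C| + 1) = `|C| * x + x by ring.
lra.
Qed.

(** Among the subspaces inside P one has maximal dimension; a vector of P outside it would enlarge
    it. *)
Lemma subspace_vspace (K : fieldType) (V : vectType K) (P : V -> Prop) :
  P 0 -> (forall a u v, P u -> P v -> P (a *: u + v)) ->
  exists U : {vspace V}, forall v, v \in U <-> P v.
Proof.
move=> P0 PL.
pose Q n := `[< exists2 U : {vspace V}, \dim U = n & forall v, v \in U -> P v >].
have Q0 : exists n, Q n.
  by exists 0%N; apply/asboolP; exists 0%VS; rewrite ?dimv0// => v; rewrite memv0 => /eqP ->.
have Qub n : Q n -> (n <= \dim {: V})%N.
  by move=> /asboolP[U <- _]; exact/dimvS/subvf.
case: (ex_maxnP Q0 Qub) => n /asboolP[U dU UP] nmax.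
exists U => v; split=> [/UP//|Pv]; apply/negP => vU.
have : (\dim (U + <[v]>) <= n)%N.
  apply: nmax; apply/asboolP; exists (U + <[v]>)%VS => // w /memv_addP[u uU [z /vlineP[a ->] ->]].
  by rewrite addrC; apply: PL => //; exact: UP.
rewrite -dU leqNgt => /negP; apply.
rewrite ltnNge; apply/negP => dle; apply: vU.
have /eqP : U == (U + <[v]>)%VS by rewrite eqEdim addvSl.
by move=> ->; rewrite memvE addvSr.
Qed.

Lemma normmx_tr (R : realType) m n (A : 'M[R]_(m, n)) : `|A^T| = `|A|.
Proof.
apply/eqP; rewrite eq_le; apply/andP; split; apply: normmx_le => // i j.
  by rewrite mxE normmx_ge.
by have := normmx_ge A^T j i; rewrite mxE.
Qed.

(** * Frobenius norm and quadratic forms *)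

Definition sqnorm (R : realType) m n (A : 'M[R]_(m, n)) : R := \sum_i \sum_j A i j ^+ 2.

Definition frob (R : realType) m n (A B : 'M[R]_(m, n)) : R := \sum_i \sum_j A i j * B i j.

Lemma sqnorm_ge0 (R : realType) m n (A : 'M[R]_(m, n)) : 0 <= sqnorm A.
Proof. by apply: sumr_ge0 => i _; apply: sumr_ge0 => j _; exact: sqr_ge0. Qed.

Lemma sqnorm_ge (R : realType) m n (A : 'M[R]_(m, n)) : `|A| ^+ 2 <= sqnorm A.
Proof.
have le1 i j : A i j ^+ 2 <= sqnorm A.
  rewrite /sqnorm (bigD1 i)//= (bigD1 j)//= -addrA lerDl addr_ge0//.
    by apply: sumr_ge0 => k _; exact: sqr_ge0.
  by apply: sumr_ge0 => k _; apply: sumr_ge0 => l _; exact: sqr_ge0.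
rewrite -[leRHS]sqr_sqrtr ?sqnorm_ge0// ler_pXn2r ?nnegrE ?sqrtr_ge0//.
apply: normmx_le => [|i j]; first exact: sqrtr_ge0.
by rewrite -sqrtr_sqr ler_wsqrtr.
Qed.

Lemma sqnorm_le (R : realType) m n (A : 'M[R]_(m, n)) : sqnorm A <= (m * n)%:R * `|A| ^+ 2.
Proof.
apply: le_trans (_ : \sum_(i < m) \sum_(j < n) `|A| ^+ 2 <= _).
  apply: ler_sum => i _; apply: ler_sum => j _.
  by rewrite -[A i j ^+ 2]real_normK ?num_real// ler_pXn2r ?nnegrE// normmx_ge.
by rewrite !sumr_const !card_ord -mulrnA mulr_natl mulnC.
Qed.

Lemma sqnorm_mid (R : realType) m n (A B : 'M[R]_(m, n)) :
  sqnorm (2^-1 *: (A + B)) = (sqnorm A + sqnorm B) / 2 - sqnorm (A - B) / 4.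
Proof.
rewrite /sqnorm -big_split/= !mulr_suml -sumrB; apply: eq_bigr => i _.
rewrite -big_split/= !mulr_suml -sumrB; apply: eq_bigr => j _.
by rewrite !mxE; field.
Qed.

(** The left side is the tangent at B of the convex function [sqnorm]. Being affine in A it is
    Lipschitz, so [cluster_pt_le] applies to it where [sqnorm] itself is not globally Lipschitz. *)
Lemma frob_sqnorm (R : realType) m n (A B : 'M[R]_(m, n)) :
  2 * frob A B - sqnorm B <= sqnorm A.
Proof.
rewrite /frob /sqnorm mulr_sumr -sumrB; apply: ler_sum => i _.
rewrite mulr_sumr -sumrB; apply: ler_sum => j _.
by have := sqr_ge0 (A i j - B i j); rewrite sqrrB; lra.
Qed.

Lemma frob_self (R : realType) m n (A : 'M[R]_(m, n)) : frob A A = sqnorm A.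
Proof. by apply: eq_bigr => i _; apply: eq_bigr => j _; rewrite expr2. Qed.

Lemma frob_lip (R : realType) m n (A A' B : 'M[R]_(m, n)) :
  `|frob A B - frob A' B| <= (m * n)%:R * (`|A - A'| * `|B|).
Proof.
rewrite /frob -sumrB; apply: le_trans (ler_norm_sum _ _ _) _.
apply: le_trans (_ : \sum_(i < m) \sum_(j < n) `|A - A'| * `|B| <= _); last first.
  by rewrite !sumr_const !card_ord -mulrnA mulr_natl mulnC.
apply: ler_sum => i _; rewrite -sumrB; apply: le_trans (ler_norm_sum _ _ _) _.
apply: ler_sum => j _; rewrite -mulrBl normrM ler_pM ?normmx_ge//.
by have := normmx_ge (A - A') i j; rewrite !mxE.
Qed.

Definition qform (R : realType) n (P : 'M[R]_n) (v : 'cV[R]_n) : R := (v^T *m P *m v) 0 0.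

Lemma qform_mul (R : realType) m n (P : 'M[R]_m) (g : 'M[R]_(m, n)) v :
  qform (g^T *m P *m g) v = qform P (g *m v).
Proof. by rewrite /qform trmx_mul !mulmxA. Qed.

Lemma qformD (R : realType) n (P Q : 'M[R]_n) v : qform (P + Q) v = qform P v + qform Q v.
Proof. by rewrite /qform mulmxDr mulmxDl mxE. Qed.

Lemma qformZ (R : realType) n a (P : 'M[R]_n) v : qform (a *: P) v = a * qform P v.
Proof. by rewrite /qform -scalemxAr -scalemxAl mxE. Qed.

Lemma qform1 (R : realType) n (v : 'cV[R]_n) : `|v| ^+ 2 <= qform 1%:M v.
Proof.
apply: le_trans (sqnorm_ge v) _; rewrite /qform mulmx1 mxE /sqnorm.
by apply: ler_sum => i _; rewrite big_ord1 mxE expr2.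
Qed.

Lemma qform_lip (R : realType) n (P Q : 'M[R]_n) v :
  `|qform P v - qform Q v| <= n%:R * (n%:R * `|v| * `|v|) * `|P - Q|.
Proof.
have -> : qform P v - qform Q v = qform (P - Q) v.
  by rewrite -[- Q]scaleN1r qformD qformZ mulN1r.
apply: le_trans (normmx_ge _ _ _) _; apply: le_trans (normmx_mul _ _) _.
have := normmx_mul v^T (P - Q); rewrite normmx_tr => h.
have -> : n%:R * (n%:R * `|v| * `|v|) * `|P - Q| = n%:R * (n%:R * `|v| * `|P - Q|) * `|v|.
  by ring.
by rewrite ler_wpM2r// ler_wpM2l.
Qed.

Lemma normmx_conj (R : realType) m n (P : 'M[R]_m) (g : 'M[R]_(m, n)) :
  `|g^T *m P *m g| <= (m%:R * `|g|) ^+ 2 * `|P|.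
Proof.
apply: le_trans (normmx_mul _ _) _; have := normmx_mul g^T P; rewrite normmx_tr => h.
have -> : (m%:R * `|g|) ^+ 2 * `|P| = m%:R * (m%:R * `|g| * `|P|) * `|g| by ring.
by rewrite ler_wpM2r// ler_wpM2l.
Qed.

(* A form P that minimises sup_g |P o g|, with g in S or g = 1, among the
   symmetric forms whose translates are bounded below is unique by the
   parallelogram identity, hence invariant. *)
Lemma bounded_group_form (R : realType) n (S : set 'M[R]_n) M :
  (forall g h, S g -> S h -> S (g *m h)) ->
  (forall g, S g -> [/\ g \in unitmx, `|g| <= M & `|invmx g| <= M]) ->
  exists P : 'M[R]_n, [/\ P^T = P,
    (exists2 c, 0 < c & forall v, c * `|v| ^+ 2 <= qform P v) &
    forall g, S g -> g^T *m P *m g = P].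
Proof.
move=> Smul SM.
have arith (x y q : R) : 0 <= x -> y <= x -> q <= 1 -> (x + 2) ^+ 2 <= y + q -> False.
  by move=> x0 yx q1; rewrite sqrrD; have := sqr_ge0 x; lra.
pose T : set 'M[R]_n := [set g | S g \/ g = 1%:M].
pose B := Num.max M `|1%:M : 'M[R]_n|.
have TM g : T g -> [/\ g \in unitmx, `|g| <= B & `|invmx g| <= B].
  case=> [/SM[h1 h2 h3]|->]; first by split=> //; rewrite le_max ?h2 ?h3.
  by rewrite unitmx1 invmx1 !le_max !lexx !orbT.
have B0 : 0 <= B by rewrite le_max normr_ge0 orbT.
pose b := n%:R * B + 1; have b0 : 0 < b by rewrite ltr_wpDl// mulr_ge0.
have Tb g v : T g -> `|v| <= b * `|g *m v|.
  move=> /TM[ug _ gB]; rewrite -{1}[v](mulKmx ug).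
  apply: le_trans (normmx_mul _ _) _; rewrite ler_wpM2r// /b.
  by apply: le_trans (ler_wpM2l _ gB) _; rewrite ?lerDl.
have Tb' g P : T g -> `|g^T *m P *m g| <= b ^+ 2 * `|P|.
  move=> /TM[_ gB _]; apply: le_trans (normmx_conj _ _) _; rewrite ler_wpM2r//.
  rewrite ler_pXn2r ?nnegrE ?(ltW b0) ?mulr_ge0//.
  by rewrite /b (le_trans (ler_wpM2l _ gB))// lerDl.
have Tc g P : T g -> `|P| <= b ^+ 2 * `|g^T *m P *m g|.
  move=> /TM[ug _ gB].
  have {1}-> : P = (invmx g)^T *m (g^T *m P *m g) *m invmx g.
    rewrite trmx_inv !mulmxA mulVmx ?unitmx_tr// mul1mx -mulmxA mulmxV//.
    by rewrite mulmx1.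
  apply: le_trans (normmx_conj _ _) _; rewrite ler_wpM2r//.
  rewrite ler_pXn2r ?nnegrE ?(ltW b0) ?mulr_ge0//.
  by rewrite /b (le_trans (ler_wpM2l _ gB))// lerDl.
(* The lower bound satisfied by all translates of the identity form. Built into [good], it keeps the
   minimiser definite. *)
pose c := b ^- 2; have c0 : 0 < c by rewrite invr_gt0 exprn_gt0.
pose good D (P : 'M[R]_n) := P^T = P /\ forall g, T g ->
  (forall v, c * `|v| ^+ 2 <= qform P (g *m v)) /\ sqnorm (g^T *m P *m g) <= D.
have goodW D D' P : D <= D' -> good D P -> good D' P.
  move=> DD [Ps HP]; split=> // g Tg; have [h1 h2] := HP g Tg; split=> //.
  exact: le_trans DD.
pose X := [set D | exists P, good D P].
have Xne : X !=set0.
  exists ((n * n)%:R * (b ^+ 2 * `|1%:M : 'M[R]_n|) ^+ 2), 1%:M.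
  split=> [|g Tg]; first by rewrite trmx1.
  split=> [v|].
    apply: le_trans (qform1 _); rewrite /c ler_pdivrMl ?exprn_gt0// -exprMn.
    by rewrite ler_pXn2r ?nnegrE ?mulr_ge0 ?(ltW b0)// Tb.
  apply: le_trans (sqnorm_le _) _; rewrite ler_wpM2l//.
  rewrite ler_pXn2r ?nnegrE ?mulr_ge0 ?sqr_ge0 ?(ltW b0)//.
  exact: Tb'.
have Xlb : has_lbound X.
  exists 0 => D [P [_ HP]]; have [_ h] := HP 1%:M (or_intror erefl).
  exact: le_trans (sqnorm_ge0 _) h.
have hX : has_inf X by split.
pose D0 := inf X.
have D0le D : X D -> D0 <= D by move=> XD; exact: ge_inf.
have [P goodP] : exists P, good D0 P.
  have /choice[u Hu] : forall k : nat, exists P, good (D0 + k.+1%:R^-1) P.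
    move=> k; have k0 : 0 < k.+1%:R^-1 :> R by rewrite invr_gt0.
    have [D [P HP] DD] := inf_adherent k0 hX.
    by exists P; apply: goodW HP; exact: ltW.
  have T1 : T 1%:M by right.
  have uD k : `|u k| <= `|D0| + 2.
    have [_ /(_ _ T1)[_]] := Hu k; rewrite trmx1 mul1mx mulmx1 => h.
    have h1 := le_trans (sqnorm_ge _) h.
    have h2 : k.+1%:R^-1 <= 1 :> R by rewrite invf_le1 ?ltr0n// ler1n.
    have h3 := ler_norm D0; have h4 := normr_ge0 D0.
    rewrite leNgt; apply/negP => h5.
    have h6 : (`|D0| + 2) ^+ 2 <= `|u k| ^+ 2.
      by rewrite ler_pXn2r ?nnegrE ?addr_ge0// ltW.
    exact: arith h4 h3 h2 (le_trans h6 h1).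
  have [P clP] := bounded_cluster_pt uD; exists P.
  have eventually_le e : 0 < e -> exists N, forall k, (N <= k)%N -> k.+1%:R^-1 <= e :> R.
    move=> e0; exists (Num.truncn e^-1) => k Nk.
    rewrite -[e]invrK lef_pV2 ?posrE ?invr_gt0 ?ltr0n//.
    by rewrite (le_trans (ltW (truncnS_gt _)))// ler_nat.
  split.
    apply/matrixP => i j; apply/eqP; rewrite -subr_eq0 -normr_le0.
    apply: (@cluster_pt_le _ _ _ u P (fun A => `|A^T i j - A i j|) 2 0) => //.
      move=> A; apply: le_trans (ler_dist_dist _ _) _.
      rewrite !mxE; have := normmx_ge (A - P) i j; have := normmx_ge (A - P) j i.
      rewrite !mxE => h1 h2.
      have -> : A j i - A i j - (P j i - P i j) = (A j i - P j i) - (A i j - P i j) by ring.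
      by apply: le_trans (ler_normB _ _) _; rewrite mulrDl mul1r lerD.
    by move=> e e0; exists 0%N => k _; have [-> _] := Hu k; rewrite subrr normr0 addr_ge0// ltW.
  move=> g Tg; split=> [v|].
    rewrite -lerN2.
    apply: (@cluster_pt_le _ _ _ u P (fun A => - qform A (g *m v)) _ _ clP).
      by move=> A; rewrite -opprD normrN; exact: qform_lip.
    move=> e e0; exists 0%N => k _; have [_ /(_ _ Tg)[h _]] := Hu k.
    by have := h v; lra.
  set Y := g^T *m P *m g.
  suff : 2 * frob Y Y - sqnorm Y <= D0 by rewrite frob_self; lra.
  apply: (@cluster_pt_le _ _ _ u P (fun A => 2 * frob (g^T *m A *m g) Y - sqnorm Y)
    (2 * ((n * n)%:R * (b ^+ 2 * `|Y|))) _ clP).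
    move=> A; rewrite opprB addrA subrK -mulrBr normrM ger0_norm//.
    have -> : 2 * ((n * n)%:R * (b ^+ 2 * `|Y|)) * `|A - P| =
      2 * ((n * n)%:R * ((b ^+ 2 * `|A - P|) * `|Y|)) by ring.
    rewrite ler_wpM2l//; apply: le_trans (frob_lip _ _ _) _.
    rewrite ler_wpM2l// ler_wpM2r//.
    by rewrite -mulmxBl -mulmxBr Tb'.
  move=> e e0; have [N HN] := eventually_le e e0; exists N => k Nk.
  have [_ /(_ _ Tg)[_ h]] := Hu k; apply: le_trans (frob_sqnorm _ _) _.
  by apply: le_trans h _; rewrite lerD2l HN.
have uniq Q : good D0 Q -> Q = P.
  move=> goodQ; have [Ps HP] := goodP; have [Qs HQ] := goodQ.
  (* The gain of the midpoint of P and Q over D0. It is uniform in g, since translation by g shrinks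
     a matrix at most by the factor b^2. *)
  pose e := (`|P - Q| / b ^+ 2) ^+ 2 / 4.
  have : D0 <= D0 - e.
    apply: D0le; exists (2^-1 *: (P + Q)); split; first by rewrite linearZ/= linearD/= Ps Qs.
    move=> g Tg; have [p1 p2] := HP g Tg; have [q1 q2] := HQ g Tg; split=> [v|].
      by rewrite qformZ qformD; have := p1 v; have := q1 v; lra.
    rewrite -scalemxAr -scalemxAl mulmxDr mulmxDl sqnorm_mid -mulmxBl -mulmxBr.
    have h : (`|P - Q| / b ^+ 2) ^+ 2 <= sqnorm (g^T *m (P - Q) *m g).
      apply: le_trans (sqnorm_ge _); rewrite ler_pXn2r ?nnegrE ?divr_ge0 ?sqr_ge0//.
      by rewrite ler_pdivrMr ?exprn_gt0// mulrC Tc.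
    rewrite /e; lra.
  rewrite lerDl oppr_ge0 /e => h.
  have : (`|P - Q| / b ^+ 2) ^+ 2 <= 0 by lra.
  have := sqr_ge0 (`|P - Q| / b ^+ 2) => h2 h3.
  have : (`|P - Q| / b ^+ 2) ^+ 2 == 0 by rewrite eq_le h3 h2.
  rewrite sqrf_eq0 mulf_eq0 normr_eq0 subr_eq0 invr_eq0 expf_eq0 (gt_eqF b0) andbF orbF.
  by move=> /eqP.
exists P; have [Ps HP] := goodP; split=> //.
  exists c => // v; have [h _] := HP 1%:M (or_intror erefl).
  by have := h v; rewrite mul1mx.
(* Left multiplication by h maps T into itself, so the translate of P by h is a minimiser too. *)
move=> h Sh; apply: uniq; split.
  by rewrite !trmx_mul trmxK Ps mulmxA.
move=> g Tg; have Thg : T (h *m g).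
  by case: Tg => [Sg|->]; left; [exact: Smul|rewrite mulmx1].
have [h1 h2] := HP _ Thg; split=> [v|].
  by rewrite qform_mul mulmxA.
by move: h2; rewrite trmx_mul !mulmxA.
Qed.

(** * Irreducible bounded monoids *)

(** Phrased with predicates, so that subspaces such as the vectors with bounded orbit can be used as
    they come. *)
Definition irreducible_set (R : realType) d (S : set 'M[R]_d) : Prop :=
  forall P : 'cV[R]_d -> Prop, P 0 -> (forall a u v, P u -> P v -> P (a *: u + v)) ->
  (forall g v, S g -> P v -> P (g *m v)) ->
  (forall v, P v -> v = 0) \/ (forall v, P v).

(** Duality: if a row space of maximal rank inside P is not full, some nonzero column of its
    cokernel is annihilated by it; a row of P that does not kill this column would raise the
    rank. *)
Lemma row_predicate_full (R : realType) d (P : 'rV[R]_d -> Prop) :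
  P 0 -> (forall a u v, P u -> P v -> P (a *: u + v)) ->
  (forall v : 'cV[R]_d, (forall f, P f -> f *m v = 0) -> v = 0) -> forall f, P f.
Proof.
move=> P0 PL ann.
pose Q n := `[< exists2 Y : 'M[R]_d, \rank Y = n & forall x, (x <= Y)%MS -> P x >].
have Q0 : exists n, Q n.
  by exists 0%N; apply/asboolP; exists 0; rewrite ?mxrank0// => x; rewrite submx0 => /eqP ->.
have Qub n : Q n -> (n <= d)%N by move=> /asboolP[Y <- _]; exact: rank_leq_row.
case: (ex_maxnP Q0 Qub) => n /asboolP[Y dY YP] nmax f; apply: (YP).
suff full : row_full Y by exact: submx_full.
apply: contrapT => nfull.
have ck : cokermx Y != 0.
  apply/eqP => ck0; apply: nfull; rewrite -sub1mx.
  by rewrite submxE ck0 mulmx0.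
have [j cj] : exists j, col j (cokermx Y) != 0.
  apply: contrapT => H; move/eqP: ck; apply; apply/matrixP => i j; rewrite [RHS]mxE.
  have [/eqP e|e] := boolP (col j (cokermx Y) == 0); last by case: H; exists j.
  by have := congr1 (fun v : 'cV[R]_d => v i 0) e; rewrite !mxE.
set v := col j (cokermx Y) in cj.
have Yv : Y *m v = 0 by rewrite /v colE mulmxA mulmx_coker mul0mx.
have [h Ph hv] : exists2 h, P h & h *m v != 0.
  apply: contrapT => H; move/eqP: cj; apply; apply: ann => h Ph.
  by apply: contrapT => /eqP hv; apply: H; exists h.
have : (\rank (Y + h)%MS <= n)%N.
  apply: nmax; apply/asboolP; exists (Y + h)%MS => // x /sub_addsmxP[[a b] ->] /=.
  rewrite addrC (mx11_scalar b) mul_scalar_mx; apply: PL => //.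
  by apply: YP; exact: submxMl.
rewrite -dY leqNgt => /negP; apply.
rewrite ltn_neqAle mxrankS ?addsmxSl// andbT; apply/eqP => e.
have := mxrank_leqif_eq (addsmxSl Y h) => -[_]; rewrite e eqxx => /esym/eqmxP H.
have : (h <= Y)%MS by rewrite H addsmxSr.
by move=> /submxP[D hD]; move/eqP: hv; apply; rewrite hD -mulmxA Yv mulmx0.
Qed.

Definition closure_set (R : realType) d (S : set 'M[R]_d) : set 'M[R]_d :=
  [set g | forall e, 0 < e -> exists2 s, S s & `|s - g| < e].

Lemma closure_set_mul (R : realType) d (S : set 'M[R]_d) M :
  (forall g h, S g -> S h -> S (g *m h)) -> (forall g, S g -> `|g| <= M) ->
  forall g h, closure_set S g -> closure_set S h -> closure_set S (g *m h).
Proof.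
move=> Smul SM g h Cg Ch e e0.
pose c := d%:R * (`|M| + `|h|) + 1.
have c0 : 0 < c by rewrite ltr_wpDl// mulr_ge0// addr_ge0.
have [s Ss sg] := Cg (e / c) (divr_gt0 e0 c0).
have [t St th] := Ch (e / c) (divr_gt0 e0 c0).
exists (s *m t); first exact: Smul.
have -> : s *m t - g *m h = s *m (t - h) + (s - g) *m h.
  by rewrite mulmxBr mulmxBl addrA subrK.
apply: le_lt_trans (ler_normD _ _) _.
have h1 : `|s *m (t - h)| <= d%:R * `|M| * (e / c).
  apply: le_trans (normmx_mul _ _) _; apply: ler_pM => //; last exact: ltW.
  by rewrite ler_wpM2l// (le_trans (SM _ Ss))// ler_norm.
have h2 : `|(s - g) *m h| <= d%:R * (e / c) * `|h|.
  apply: le_trans (normmx_mul _ _) _; rewrite ler_wpM2r// ler_wpM2l//; exact: ltW.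
apply: le_lt_trans (lerD h1 h2) _.
have -> : d%:R * `|M| * (e / c) + d%:R * (e / c) * `|h| = (c - 1) * (e / c).
  by rewrite /c; ring.
rewrite mulrBl mul1r mulrC divfK ?gt_eqF// ltrBlDr ltrDl; exact: divr_gt0.
Qed.

Lemma closure_set_cluster (R : realType) d (S : set 'M[R]_d) u p :
  (forall k, closure_set S (u k)) -> cluster_pt u p -> closure_set S p.
Proof.
move=> Cu cl e e0; have e20 : 0 < e / 2 by rewrite divr_gt0.
have [k _ kp] := cl _ e20 0%N; have [s Ss sk] := Cu k _ e20; exists s => //.
have -> : s - p = (s - u k) + (u k - p) by rewrite addrA subrK.
apply: le_lt_trans (ler_normD _ _) _; lra.
Qed.

Lemma closure_set_norm (R : realType) d (S : set 'M[R]_d) M eta :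
  (forall g, S g -> eta <= `|g| <= M) -> forall g, closure_set S g -> eta <= `|g| <= M.
Proof.
move=> SM g Cg; apply/andP; split; apply/ler_addgt0Pr => e e0.
  have [s Ss sg] := Cg e e0; have /andP[h _] := SM s Ss.
  have := ler_normD (s - g) g; rewrite subrK; lra.
have [s Ss sg] := Cg e e0; have /andP[_ h] := SM s Ss.
have := ler_normD (g - s) s; rewrite subrK distrC in sg *; lra.
Qed.

(** If the inverses X of u k were unbounded, let p be a cluster point with inverse I. From X = I - I
    (u k - p) X, |X| <= 2 |I| once u k is close to p. *)
Lemma compact_inverse_bound (R : realType) n (K : set 'M[R]_n) M :
  (forall g, K g -> g \in unitmx) -> (forall g, K g -> `|g| <= M) ->
  (forall u p, (forall k, K (u k)) -> cluster_pt u p -> K p) ->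
  exists B, forall g, K g -> `|invmx g| <= B.
Proof.
move=> Ku KM Kcl; apply: contrapT => H.
have /choice[u Hu] : forall k : nat, exists g, K g /\ k%:R < `|invmx g|.
  move=> k; apply: contrapT => Hk; apply: H; exists k%:R => g Kg.
  by rewrite leNgt; apply/negP => h; apply: Hk; exists g.
have [p clp] := bounded_cluster_pt (fun k => KM _ (Hu k).1).
have Kp := Kcl _ _ (fun k => (Hu k).1) clp.
pose I := invmx p; pose c := n%:R * n%:R * `|I| + 1.
have c0 : 0 < c by rewrite ltr_wpDl// !mulr_ge0.
have half0 : 0 < 2^-1 :> R by rewrite invr_gt0.
have [k Nk kp] := clp (2^-1 / c) (divr_gt0 half0 c0)
  (Num.truncn (2 * `|I|)).+1.
have [Kk kI] := Hu k; set X := invmx (u k) in kI.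
have E : X = I - I *m (u k - p) *m X.
  rewrite mulmxBr mulVmx ?Ku// mulmxBl mul1mx -mulmxA mulmxV ?Ku// mulmx1.
  by rewrite opprB addrCA subrr addr0.
have h1 : `|X| <= `|I| + n%:R * (n%:R * `|I| * `|u k - p|) * `|X|.
  rewrite {1}E; apply: le_trans (ler_normB _ _) _; rewrite lerD2l.
  apply: le_trans (normmx_mul _ _) _; rewrite ler_wpM2r// ler_wpM2l//.
  exact: normmx_mul.
have h2 : n%:R * (n%:R * `|I| * `|u k - p|) <= 2^-1.
  rewrite ltr_pdivlMr// in kp.
  have : `|u k - p| * c = n%:R * (n%:R * `|I| * `|u k - p|) + `|u k - p| by rewrite /c; ring.
  have := normr_ge0 (u k - p); lra.
have h3 : n%:R * (n%:R * `|I| * `|u k - p|) * `|X| <= 2^-1 * `|X| by rewrite ler_wpM2r.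
have h4 : 2 * `|I| < k%:R.
  by apply: lt_le_trans (truncnS_gt _) _; rewrite ler_nat.
move: h1 h3 h4 kI; move: (`|X|) (`|I|) (_ * `|X|) => x i q; lra.
Qed.

(** An injective endomorphism of a finite-dimensional space is onto. This turns invariance under the
    monoid into invariance under inverses of its elements. *)
Lemma invariant_predicate_onto (K : fieldType) (V : vectType K) (P : V -> Prop)
    (f : {linear V -> V}) :
  P 0 -> (forall a u v, P u -> P v -> P (a *: u + v)) ->
  injective f -> (forall v, P v -> P (f v)) -> forall v, P v -> exists2 u, P u & f u = v.
Proof.
move=> P0 PL finj Pf v Pv; have [U HU] := subspace_vspace P0 PL.
have sub : (linfun f @: U <= U)%VS.
  by apply/subvP => w /memv_imgP[u uU ->]; rewrite lfunE/=; apply/HU/Pf/HU.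
have ker : (U :&: lker (linfun f))%VS = 0%VS.
  apply/eqP; rewrite -subv0; apply/subvP => w; rewrite memv_cap memv_ker lfunE/=.
  by case/andP => _ /eqP fw; rewrite memv0; apply/eqP/finj; rewrite fw linear0.
have /eqP eU : (linfun f @: U == U)%VS by rewrite eqEdim sub limg_dim_eq//=.
have /HU : P v by []; rewrite -eU => /memv_imgP[u uU ->].
by exists u; [exact/HU|rewrite lfunE].
Qed.

(* Let e be of minimal rank in the closure C of S, with e = W R and W, R of full
   rank.  The matrices R h W with h in C form a bounded group, so they preserve
   a positive form P.  Then Q = R^T P R satisfies
   <Q, h xi h^T> = <Q, xi> for all h in S and xi = u u^T with u = h' W z.  The
   matrices xi with this property form a subspace that xi |-> g xi g^T maps into,
   hence onto, itself; so Q (h g^-1 u) does not depend on g and h, and by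
   irreducibility the inverses of the elements of S are bounded. *)
Lemma irreducible_bounded_form (R : realType) d (S : set 'M[R]_d) M eta :
  (0 < d)%N -> S 1%:M -> (forall g h, S g -> S h -> S (g *m h)) ->
  irreducible_set S -> (forall g, S g -> g \in unitmx) -> 0 < eta ->
  (forall g, S g -> eta <= `|g| <= M) ->
  exists P : 'M[R]_d, [/\ P^T = P,
    (exists2 c, 0 < c & forall v, c * `|v| ^+ 2 <= qform P v) &
    forall g, S g -> g^T *m P *m g = P].
Proof.
move=> d0 S1 Smul Sirr Su eta0 SM.
pose C := closure_set S.
have SC g : S g -> C g by move=> Sg e e0; exists g; rewrite ?subrr ?normr0.
have SMr g : S g -> `|g| <= M by move=> /SM/andP[].
have Cmul := closure_set_mul Smul SMr.
have CM := closure_set_norm SM.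
have M0 : 0 <= M by apply: le_trans (SMr _ S1).
pose rk n := `[< exists2 e, C e & \rank e = n >].
have rk0 : exists n, rk n.
  by exists (\rank (1%:M : 'M[R]_d)); apply/asboolP; exists 1%:M => //; exact: SC.
case: (ex_minnP rk0) => r /asboolP[e Ce er] rmin; subst r.
(* The lower bound eta passes to the closure, so the minimal rank is not 0. *)
have e0 : e != 0.
  by apply/eqP => e0; have /andP[] := CM _ Ce; rewrite e0 normr0 leNgt eta0.
set r := \rank e in rmin; pose W : 'M[R]_(d, r) := col_base e; pose Rr : 'M[R]_(r, d) := row_base e.
have eE : e = W *m Rr by rewrite mulmx_base.
have W0 : W != 0 by apply/eqP => w0; rewrite eE w0 mul0mx eqxx in e0.
have R0 : Rr != 0 by apply/eqP => w0; rewrite eE w0 mulmx0 eqxx in e0.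
clearbody W Rr.
pose K : set 'M[R]_r := [set k | exists2 h, C h & k = Rr *m h *m W].
(* e h e = W (R h W) R lies in C, so its rank is at least r; the r x r matrix R h W thus has full
   rank. *)
have Ku k : K k -> k \in unitmx.
  move=> [h Ch ->]; rewrite -row_full_unit /row_full eqn_leq rank_leq_row/=.
  have : (r <= \rank (e *m h *m e))%N.
    by apply: rmin; apply/asboolP; exists (e *m h *m e) => //; apply: (Cmul) => //; exact: Cmul.
  move=> /leq_trans; apply.
  have -> : e *m h *m e = W *m (Rr *m h *m W) *m Rr by rewrite {1 2}eE !mulmxA.
  exact: leq_trans (mxrankM_maxl _ _) (mxrankM_maxr _ _).
pose BK := d%:R * (d%:R * `|Rr| * M) * `|W|.
have KM k : K k -> `|k| <= BK.
  move=> [h Ch ->]; apply: le_trans (normmx_mul _ _) _; rewrite ler_wpM2r// ler_wpM2l//.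
  apply: le_trans (normmx_mul _ _) _; rewrite ler_wpM2l ?mulr_ge0//.
  by have /andP[] := CM _ Ch.
have Kmul k l : K k -> K l -> K (k *m l).
  move=> [h Ch ->] [h' Ch' ->]; exists (h *m e *m h'); first by do 2 apply: (Cmul) => //.
  by rewrite eE !mulmxA.
have Kcl u p : (forall k, K (u k)) -> cluster_pt u p -> K p.
  move=> Ku' clp.
  have /choice[h Hh] : forall k, exists h, C h /\ u k = Rr *m h *m W.
    by move=> k; have [h Ch uk] := Ku' k; exists h.
  (* [s] selects indices along which u tends to p, so that a cluster point q of [h \o s] satisfies R
     q W = p. *)
  have /choice[s Hs] : forall j : nat, exists k, `|u k - p| < j.+1%:R^-1.
    move=> j; have j0 : 0 < j.+1%:R^-1 :> R by rewrite invr_gt0.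
    by have [k _ ?] := clp _ j0 0%N; exists k.
  have [|q clq] := @bounded_cluster_pt _ _ _ (h \o s) M.
    by move=> j; have /andP[] := CM _ (Hh (s j)).1.
  exists q; first by apply: closure_set_cluster clq => j; exact: (Hh (s j)).1.
  pose c := d%:R * (d%:R * `|Rr|) * `|W| + 1.
  have c0 : 0 < c by rewrite ltr_wpDl// !mulr_ge0.
  apply/eqP; rewrite -subr_eq0 -normr_le0; apply/ler_addgt0Pr => eps eps0; rewrite add0r.
  have eps20 : 0 < eps / 2 by rewrite divr_gt0.
  have [j Nj jq] := clq (eps / 2 / c) (divr_gt0 eps20 c0) (Num.truncn (eps / 2)^-1).
  have -> : p - Rr *m q *m W = Rr *m (h (s j) - q) *m W - (u (s j) - p).
    by rewrite mulmxBr mulmxBl -(Hh (s j)).2 opprB [RHS]addrC addrA subrK.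
  apply: le_trans (ler_normB _ _) _; rewrite [eps in X in _ <= X]splitr; apply: lerD.
    rewrite ltr_pdivlMr// in jq; apply: le_trans (ltW jq).
    apply: le_trans (normmx_mul _ _) _.
    apply: le_trans (_ : d%:R * (d%:R * `|Rr| * `|h (s j) - q|) * `|W| <= _).
      by rewrite ler_wpM2r// ler_wpM2l//; exact: normmx_mul.
    have -> : d%:R * (d%:R * `|Rr| * `|h (s j) - q|) * `|W| = `|h (s j) - q| * (c - 1).
      by rewrite /c; ring.
    by rewrite ler_wpM2l// gerBl.
  apply: ltW; apply: lt_le_trans (Hs j) _.
  rewrite -[eps / 2]invrK lef_pV2 ?posrE ?invr_gt0//.
  by rewrite (le_trans (ltW (truncnS_gt _)))// ler_nat.
have [BI HBI] := compact_inverse_bound Ku KM Kcl.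
have [P [Ps [c c0 Pc] PK]] : exists P : 'M[R]_r, [/\ P^T = P,
    (exists2 c, 0 < c & forall v, c * `|v| ^+ 2 <= qform P v) &
    forall g, K g -> g^T *m P *m g = P].
  apply: (bounded_group_form (M := Num.max BK BI)) => // g Kg; split; first exact: Ku.
    by rewrite le_max KM.
  by rewrite le_max HBI ?orbT.
pose Q := Rr^T *m P *m Rr.
have QW h (z : 'cV[R]_r) : C h -> qform Q (h *m (W *m z)) = qform P z.
  move=> Ch; rewrite /Q qform_mul !mulmxA -qform_mul PK//.
  by exists h.
have trQ (v : 'cV[R]_d) : \tr (Q *m (v *m v^T)) = qform Q v.
  by rewrite mulmxA mxtrace_mulC mulmxA /qform /mxtrace big_ord1.
pose X (xi : 'M[R]_d) := forall h, S h -> \tr (Q *m (h *m xi *m h^T)) = \tr (Q *m xi).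
have X0 : X 0 by move=> h _; rewrite mulmx0 mul0mx.
have XL a u v : X u -> X v -> X (a *: u + v).
  move=> Xu Xv h Sh.
  rewrite mulmxDr mulmxDl !mulmxDr -scalemxAr -scalemxAl -!scalemxAr !linearD !linearZ/=.
  by rewrite Xu// Xv.
have Xgen h (z : 'cV[R]_r) : S h -> X ((h *m (W *m z)) *m (h *m (W *m z))^T).
  move=> Sh g Sg; set v := h *m (W *m z).
  have -> : g *m (v *m v^T) *m g^T = (g *m v) *m (g *m v)^T.
    by rewrite (trmx_mul g v) !mulmxA.
  by rewrite !trQ /v (mulmxA g h) !QW//; apply: SC => //; exact: Smul.
have Xinv g xi : S g -> X xi -> X (invmx g *m xi *m (invmx g)^T).
  move=> Sg Xxi; have ug := Su _ Sg.
  pose f : {linear 'M[R]_d -> 'M[R]_d} := mulmxr g^T \o mulmx g.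
  have fK A : invmx g *m f A *m (invmx g)^T = A.
    rewrite /f/= !mulmxA mulVmx// mul1mx -mulmxA -trmx_mul mulVmx// trmx1 mulmx1//.
  have finj : injective f by move=> A B AB; rewrite -(fK A) AB fK.
  have [|zeta Xz <-] := invariant_predicate_onto X0 XL finj _ Xxi.
    move=> A XA h Sh; rewrite /f/= (XA g Sg).
    have -> : h *m (g *m A *m g^T) *m h^T = (h *m g) *m A *m (h *m g)^T.
      by rewrite trmx_mul !mulmxA.
    by rewrite XA//; exact: Smul.
  by rewrite fK.
have Qinv h g h' (z : 'cV[R]_r) : S h -> S g -> S h' ->
    qform Q (h *m (invmx g *m (h' *m (W *m z)))) = qform P z.
  move=> Sh Sg Sh'; set u := h' *m (W *m z).
  have Xu : X (u *m u^T) by exact: Xgen.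
  pose v := invmx g *m u; rewrite -/v.
  have vE : v *m v^T = invmx g *m (u *m u^T) *m (invmx g)^T.
    by rewrite /v (trmx_mul (invmx g) u) !mulmxA.
  have Xv : X (v *m v^T) by rewrite vE; exact: Xinv.
  have t1 x : S x -> qform Q (x *m v) = \tr (Q *m (v *m v^T)).
    by move=> Sx; rewrite -(Xv x Sx) -trQ (trmx_mul x v) !mulmxA.
  by rewrite t1// -(t1 g Sg) /v mulKVmx ?Su// /u QW//; exact: SC.
(* The vectors killed by all R h form an invariant subspace, which is proper because R is
   nonzero. *)
have Rinj (v : 'cV[R]_d) : (forall h, S h -> Rr *m (h *m v) = 0) -> v = 0.
  have [] := Sirr (fun v => forall h, S h -> Rr *m (h *m v) = 0).
  - by move=> h _; rewrite !mulmx0.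
  - by move=> a x y Hx Hy h Sh; rewrite mulmxDr mulmxDr -!scalemxAr Hx// Hy// scaler0 addr0.
  - by move=> g x Sg Hx h Sh; rewrite [h *m _]mulmxA Hx//; exact: Smul.
  - by move=> H; exact: H.
  - move=> H _; exfalso; move/eqP: R0; apply; apply: mulmx_ext => x.
    by rewrite mul0mx -[x]mul1mx H.
have inv_bound (u : 'cV[R]_d) : (exists h (z : 'cV[R]_r), S h /\ u = h *m (W *m z)) ->
    exists B, forall g, S g -> `|invmx g *m u| <= B.
  move=> [h' [z [Sh' ->]]]; set u0 := h' *m (W *m z).
  (* The rows of R h satisfy [bd], as P is definite and the form Q is constant on h g^-1 u0; by
     [Rinj] they have no common kernel, so they span all rows. *)
  pose bd (f : 'rV[R]_d) := exists B, forall g, S g -> `|f *m (invmx g *m u0)| <= B.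
  have bdall : forall f, bd f.
    apply: row_predicate_full.
    - by exists 0 => g _; rewrite mul0mx normr0.
    - move=> a x y [B1 H1] [B2 H2]; exists (`|a| * B1 + B2) => g Sg.
      rewrite mulmxDl; apply: le_trans (ler_normD _ _) _.
      by rewrite -scalemxAl normrZ lerD ?H2// ler_wpM2l// H1.
    - move=> v Hv; apply: Rinj => h Sh; apply/row_matrixP => i.
      rewrite row0 row_mul mulmxA; apply: Hv.
      exists (Num.sqrt (qform P z / c)) => g Sg.
      rewrite -mulmxA -row_mul; apply: le_trans (_ : `|Rr *m (h *m (invmx g *m u0))| <= _).
        apply: normmx_le => // k l; rewrite mxE; exact: normmx_ge.
      rewrite -[leLHS]ger0_norm// -sqrtr_sqr ler_wsqrtr// ler_pdivlMr// mulrC.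
      by apply: le_trans (Pc _) _; rewrite -qform_mul Qinv.
  have /choice[B HB] : forall i : 'I_d, exists B, forall g, S g -> `|(invmx g *m u0) i 0| <= B.
    move=> i; have [B HB] := bdall (delta_mx 0 i); exists B => g Sg.
    have := HB g Sg; rewrite -rowE => /(le_trans _); apply.
    by have := normmx_ge (row i (invmx g *m u0)) 0 0; rewrite [X in `|X| <= _]mxE.
  exists (\sum_i `|B i|) => g Sg; apply: normmx_le => [|i j]; first exact: sumr_ge0.
  rewrite ord1; apply: le_trans (HB i g Sg) _.
  by rewrite (bigD1 i)//= (le_trans (ler_norm _))// lerDl sumr_ge0.
pose bounded (u : 'cV[R]_d) := exists B, forall g, S g -> `|invmx g *m u| <= B.
pose lin (T : 'cV[R]_d -> Prop) := T 0 /\ forall a u v, T u -> T v -> T (a *: u + v).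
(* The intersection of all subspaces containing the vectors h W z. It is invariant and nonzero as W
   is nonzero, hence everything. *)
pose span v := forall T, lin T -> (forall h (z : 'cV[R]_r), S h -> T (h *m (W *m z))) -> T v.
have spanall v : span v.
  have [] := Sirr span.
  - by move=> T [].
  - by move=> a x y Hx Hy T LT HT; apply: LT.2; [exact: Hx|exact: Hy].
  - move=> g x Sg Hx T [T0 TL] HT; apply: (Hx (fun y => T (g *m y))).
      by split=> [|a y y' Ty Ty']; rewrite ?mulmx0// mulmxDr -scalemxAr; exact: TL.
    by move=> h z Sh; rewrite mulmxA; apply: HT; exact: Smul.
  - move=> H; exfalso; move/eqP: W0; apply; apply: mulmx_ext => x; rewrite mul0mx.
    by apply: H => T _ HT; have := HT 1%:M x S1; rewrite mul1mx.
  - exact.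
have bdall v : bounded v.
  apply: spanall.
    split=> [|a x y [B1 H1] [B2 H2]]; first by exists 0 => g _; rewrite mulmx0 normr0.
    exists (`|a| * B1 + B2) => g Sg; rewrite mulmxDr; apply: le_trans (ler_normD _ _) _.
    by rewrite -scalemxAr normrZ lerD ?H2// ler_wpM2l// H1.
  by move=> h z Sh; apply: inv_bound; exists h, z.
have /choice[B HB] : forall j : 'I_d, exists B, forall g, S g ->
    `|invmx g *m (delta_mx j 0 : 'cV[R]_d)| <= B.
  by move=> j; exact: bdall.
apply: (bounded_group_form (M := Num.max M (\sum_j `|B j|))) => // g Sg.
rewrite !le_max SMr//; split=> //; first exact: Su.
apply/orP; right; apply: normmx_le => [|i j]; first exact: sumr_ge0.
have := HB j g Sg; rewrite -colE => h.
apply: le_trans (_ : `|col j (invmx g)| <= _).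
  by have := normmx_ge (col j (invmx g)) i 0; rewrite [X in `|X| <= _]mxE.
apply: le_trans h _.
by rewrite (bigD1 j)//= (le_trans (ler_norm _))// lerDl sumr_ge0.
Qed.

(** * The monoid of dyadic flows *)

Definition posdef (R : realType) n (P : 'M[R]_n) : Prop := forall v, v != 0 -> 0 < qform P v.

(** Induction through the Schur complement D - a^-1 b b^T of the first diagonal entry. *)
Lemma cholesky (R : realType) n (P : 'M[R]_n) : P^T = P -> posdef P ->
  exists2 T : 'M[R]_n, T \in unitmx & P = T^T *m T.
Proof.
elim: n P => [|n IH] P Ps Ppos.
  by exists 1%:M; [exact: unitmx1|apply/matrixP => -[]].
move: P Ps Ppos; change n.+1 with (1 + n)%N => P.
rewrite -[P]submxK; rewrite [ulsubmx P]mx11_scalar.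
move: (ursubmx P) (dlsubmx P) (drsubmx P) (ulsubmx P 0 0) => b' b D a.
rewrite (tr_block_mx (a%:M)) => /eq_block_mx[_ bb _ Ds] Ppos; subst b'.
have bform (w : 'cV[R]_n) (z : 'M[R]_1) : qform (block_mx a%:M b^T b D) (col_mx z w) =
    (z^T *m (a *: z) + z^T *m (b^T *m w) + w^T *m b *m z + w^T *m D *m w) 0 0.
  rewrite /qform tr_col_mx -mulmxA mul_block_col mul_row_col.
  by rewrite !mulmxDr mul_scalar_mx !mulmxA !addrA.
have a0 : 0 < a.
  have := Ppos (col_mx 1%:M 0); rewrite bform trmx0 trmx1 !mulmx0 !mul0mx !addr0 mul1mx.
  rewrite !mxE eqxx mulr1; apply.
  by rewrite col_mx_eq0 negb_and oner_eq0.
pose D' := D - a^-1 *: (b *m b^T).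
have D's : D'^T = D' by rewrite /D' linearB linearZ/= trmx_mul trmxK Ds.
have D'pos : posdef D'.
  (* This first coordinate minimises the form for a given w, and the minimum is the Schur complement
     at w. *)
  move=> w w0; have := Ppos (col_mx (- a^-1 *: (b^T *m w)) w).
  rewrite col_mx_eq0 negb_and w0 orbT => /(_ isT); rewrite bform.
  set z := b^T *m w; have zT : z^T = w^T *m b by rewrite /z trmx_mul trmxK.
  have tz : (- a^-1 *: z)^T = - a^-1 *: (w^T *m b) by rewrite linearZ/= zT.
  rewrite tz scalerA mulrN mulfV ?gt_eqF// scaleN1r.
  rewrite mulmxN -!scalemxAl -scalemxAr addNr add0r scaleNr.
  rewrite /qform /D' mulmxBr mulmxBl -scalemxAr -scalemxAl !mulmxA.
  by rewrite addrC /z -!mulmxA.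
have [T' T'u DE] := IH D' D's D'pos.
pose s := Num.sqrt a; have s0 : 0 < s by rewrite sqrtr_gt0.
have s2 : s * s = a by rewrite -expr2 sqr_sqrtr// ltW.
exists (block_mx s%:M (s^-1 *: b^T) 0 T').
  by rewrite unitmxE det_ublock det_scalar1 unitrM -unitmxE T'u unitfE gt_eqF.
rewrite (tr_block_mx s%:M) mulmx_block tr_scalar_mx !trmx0 !mul0mx !mulmx0 !addr0.
have tb : (s^-1 *: b^T)^T = s^-1 *: b by rewrite linearZ/= trmxK.
rewrite tb -DE -scalar_mxM s2 mul_scalar_mx mul_mx_scalar !scalerA.
rewrite mulfV ?gt_eqF// !scale1r -scalemxAl -scalemxAr scalerA -invfM s2.
by rewrite /D' addrC subrK.
Qed.

Lemma flow_expand_mx (R : realType) d (M : 'M[R]_d) : exists2 C, 0 <= C & forall tau,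
  0 <= tau -> tau <= 1 -> `|flow M tau - 1%:M - tau *: M| <= C * tau ^+ 2.
Proof.
have /choice[C HC] : forall j : 'I_d, exists C, forall tau, 0 <= tau -> tau <= 1 ->
    `|flow M tau *m delta_mx j 0 - delta_mx j 0 - tau *: (M *m (delta_mx j 0 : 'cV[R]_d))|
      <= C * tau ^+ 2.
  by move=> j; exact: flow_expand.
exists (\sum_j `|C j|) => [|tau t0 t1]; first exact: sumr_ge0.
apply: normmx_le => [|i j]; first by rewrite mulr_ge0 ?sqr_ge0// sumr_ge0.
have -> : (flow M tau - 1%:M - tau *: M) i j =
    (flow M tau *m delta_mx j 0 - delta_mx j 0 - tau *: (M *m (delta_mx j 0 : 'cV[R]_d))) i 0.
  by rewrite -!colE !mxE eqxx andbT.
apply: le_trans (normmx_ge _ _ _) _; apply: le_trans (HC j tau t0 t1) _.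
rewrite ler_wpM2r ?sqr_ge0// (bigD1 j)//= (le_trans (ler_norm _))// lerDl sumr_ge0//.
Qed.

(** Z is the matrix of v - proj v. Membership becomes an equation, which can be checked up to
    arbitrarily small errors. *)
Lemma vspace_kernel (R : realType) d (U : {vspace 'cV[R]_d}) :
  exists Z : 'M[R]_d, forall v, v \in U <-> Z *m v = 0.
Proof.
pose L (w : 'cV[R]_d) := w - projv U w.
exists (\matrix_(i, j) L (delta_mx j 0) i 0) => v.
have -> : (\matrix_(i, j) L (delta_mx j 0) i 0) *m v = L v.
  apply/colP => i; rewrite mxE.
  have -> : L v = \sum_j v j 0 *: L (delta_mx j 0).
    rewrite {1}(matrix_sum_delta v) /L linear_sum/= -sumrB; apply: eq_bigr => j _.
    by rewrite big_ord1 linearZ/= -scalerBr.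
  by rewrite summxE; apply: eq_bigr => j _; rewrite [LHS]mulrC [in LHS]mxE [in RHS]mxE.
split=> [vU|/eqP]; first by rewrite /L projv_id// subrr.
by rewrite subr_eq0 => /eqP ->; exact: memv_proj.
Qed.

Lemma word_flow_refine (R : realType) d (F : set 'M[R]_d) delta w k : 0 <= delta ->
  word_in F w -> exists w', [/\ word_in F w', size w' = (size w * 2 ^ k)%N &
    word_flow (delta / 2 ^+ k) w' = word_flow delta w].
Proof.
move=> d0 Fw; elim: k => [|k [w' [Fw' sw' E]]].
  by exists w; rewrite muln1 expr0 divr1.
exists (flatten [seq [:: a; a] | a <- w']); split.
- by move=> a /flattenP[s /mapP[b bw ->]]; rewrite !inE orbb => /eqP ->; exact: Fw'.
- by rewrite expnS mulnCA -sw'; elim: (w') => //= a l ->; rewrite mulnS.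
rewrite -E; elim: w' {Fw' sw' E} => [//|a l IH] /=.
rewrite IH -mulmxA; congr (_ *m _).
have k0 : 0 <= delta / 2 ^+ k by rewrite divr_ge0// exprn_ge0.
rewrite [RHS](flow_half _ k0).
by rewrite exprSr invfM mulrA.
Qed.

Definition dyadic_flows (R : realType) d (F : set 'M[R]_d) (delta : R) : set 'M[R]_d :=
  [set g | exists n w, word_in F w /\ g = word_flow (delta / 2 ^+ n) w].

Lemma dyadic_flows_refine (R : realType) d (F : set 'M[R]_d) delta n k w : 0 <= delta ->
  (n <= k)%N -> word_in F w -> exists w', [/\ word_in F w', size w' = (size w * 2 ^ (k - n))%N &
    word_flow (delta / 2 ^+ k) w' = word_flow (delta / 2 ^+ n) w].
Proof.
move=> d0 nk Fw; have dn0 : 0 <= delta / 2 ^+ n by rewrite divr_ge0// exprn_ge0.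
have [w' [h1 h2 h3]] := word_flow_refine (k - n) dn0 Fw.
exists w'; split=> //; rewrite -h3 -mulrA -invfM -exprD subnKC//.
Qed.

Lemma dyadic_flowsM (R : realType) d (F : set 'M[R]_d) delta g h : 0 <= delta ->
  dyadic_flows F delta g -> dyadic_flows F delta h -> dyadic_flows F delta (g *m h).
Proof.
move=> d0 [n [w [Fw ->]]] [m [v [Fv ->]]].
have [w' [Fw' _ <-]] := dyadic_flows_refine d0 (leq_maxl n m) Fw.
have [v' [Fv' _ <-]] := dyadic_flows_refine d0 (leq_maxr n m) Fv.
exists (maxn n m), (v' ++ w'); split; last by rewrite word_flow_cat.
by move=> a; rewrite mem_cat => /orP[/Fv'|/Fw'].
Qed.

Lemma dyadic_flows1 (R : realType) d (F : set 'M[R]_d) delta :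
  dyadic_flows F delta 1%:M.
Proof. by exists 0%N, [::]. Qed.

Lemma dyadic_flows_letter (R : realType) d (F : set 'M[R]_d) delta n A : F A ->
  dyadic_flows F delta (flow A (delta / 2 ^+ n)).
Proof.
move=> FA; exists n, [:: A]; rewrite /= mul1mx; split=> // a.
by rewrite inE => /eqP ->.
Qed.

(** A subspace, written as the kernel of Z, that is stable under the flows of A at t = delta / 2^n
    is stable under A: for v in it, t Z A v is Z applied to the second-order remainder up to sign,
    so Z A v = O(t). *)
Lemma dyadic_flows_irreducible (R : realType) d (F : set 'M[R]_d) delta :
  0 < delta -> delta <= 1 -> irreducible_family F ->
  irreducible_set (dyadic_flows F delta).
Proof.
move=> d0 d1 Firr P P0 PL Pinv.
have [U HU] := subspace_vspace P0 PL.
have [Z HZ] := vspace_kernel U.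
have [U0|UT] : U = 0%VS \/ U = fullv.
- apply: Firr => A FA v vU; apply/HZ.
  have [C C0 HC] := flow_expand_mx A.
  apply/eqP; rewrite -normr_le0.
  apply: (@le0_geometric _ _ (d%:R * `|Z| * (d%:R * C * `|v|) * delta)) => n.
  pose t := delta / 2 ^+ n.
  have t0 : 0 < t by rewrite divr_gt0// exprn_gt0.
  have t1 : t <= 1.
    by apply: le_trans d1; rewrite ler_pdivrMr ?exprn_gt0// ler_peMr ?(ltW d0)// exprn_ege1// ler1n.
  have Fv : Z *m (flow A t *m v) = 0.
    by apply/HZ/HU/Pinv; [exact: dyadic_flows_letter|exact/HU].
  have e : t *: (Z *m (A *m v)) = - (Z *m ((flow A t - 1%:M - t *: A) *m v)).
    rewrite !mulmxBl mul1mx !mulmxBr Fv (HZ v).1// -scalemxAl -scalemxAr.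
    by rewrite subrr sub0r opprK.
  have h : t * `|Z *m (A *m v)| <= t * (d%:R * `|Z| * (d%:R * C * `|v|) * t).
    rewrite -{1}[t]ger0_norm ?(ltW t0)// -normrZ e normrN.
    have -> : t * (d%:R * `|Z| * (d%:R * C * `|v|) * t) =
      d%:R * `|Z| * (d%:R * (C * t ^+ 2) * `|v|) by ring.
    apply: le_trans (normmx_mul _ _) _; rewrite ler_wpM2l ?mulr_ge0//.
    apply: le_trans (normmx_mul _ _) _; rewrite ler_wpM2r// ler_wpM2l// HC//.
    exact: ltW.
  by move: h; rewrite ler_pM2l// /t mulrA.
- by left=> v /HU; rewrite U0 memv0 => /eqP.
- by right=> v; apply/HU; rewrite UT memvf.
Qed.

Lemma unitmx_of_trivial_kernel (R : realType) d (A : 'M[R]_d) :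
  (forall v : 'cV[R]_d, A *m v = 0 -> v = 0) -> A \in unitmx.
Proof.
move=> H; rewrite -unitmx_tr -row_free_unit -kermx_eq0.
apply/eqP/row_matrixP => i; rewrite row0; apply: trmx_inj; rewrite trmx0; apply: H.
by rewrite -{1}[A]trmxK -trmx_mul -row_mul mulmx_ker row0 trmx0.
Qed.

Lemma dyadic_flows_unit (R : realType) d (F : set 'M[R]_d) K delta g : 0 < K ->
  (forall M, F M -> forall v : 'cV[R]_d, `|M *m v| <= K * `|v|) ->
  0 < delta -> K * delta <= 2^-1 -> dyadic_flows F delta g -> g \in unitmx.
Proof.
move=> K0 HK d0 Kd [n [w [Fw ->]]]; pose t := delta / 2 ^+ n; rewrite -/t.
have t0 : 0 <= t by rewrite divr_ge0 ?exprn_ge0// ltW.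
have Kt : K * t <= 2^-1.
  apply: le_trans Kd; rewrite ler_wpM2l ?(ltW K0)// ler_pdivrMr ?exprn_gt0//.
  by rewrite ler_peMr ?(ltW d0)// exprn_ege1// ler1n.
elim: w Fw => [|a l IH] Fw /=; first exact: unitmx1.
rewrite unitmx_mul IH/=; last by move=> b bl; apply: Fw; rewrite inE bl orbT.
have Fa : F a by apply: Fw; rewrite inE eqxx.
apply: unitmx_of_trivial_kernel => x fx; have := flow_ge x (ltW K0) (HK _ Fa) t0 Kt.
by rewrite fx normr0 mulr0 normr_le0 => /eqP.
Qed.

(** The vectors with bounded orbit form an invariant subspace. If it were 0, unit vectors resisting
    doubling by ever longer words would cluster at a unit vector with bounded orbit. *)
Lemma dyadic_flows_bounded (R : realType) d (F : set 'M[R]_d) K delta : (0 < d)%N ->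
  0 < K -> (forall M, F M -> forall v : 'cV[R]_d, `|M *m v| <= K * `|v|) ->
  0 < delta -> irreducible_set (dyadic_flows F delta) ->
  uniform_with F 0%E -> exists B, forall g, dyadic_flows F delta g -> `|g| <= B.
Proof.
move=> dgt0 K0 HK d0 Sirr unif; pose S := dyadic_flows F delta.
pose bd (v : 'cV[R]_d) := exists B, forall g, S g -> `|g *m v| <= B.
have [] := Sirr bd.
- by exists 0 => g _; rewrite mulmx0 normr0.
- move=> a x y [B1 H1] [B2 H2]; exists (`|a| * B1 + B2) => g Sg.
  rewrite mulmxDr; apply: le_trans (ler_normD _ _) _.
  by rewrite -scalemxAr normrZ lerD ?H2// ler_wpM2l// H1.
- move=> h x Sh [B HB]; exists B => g Sg; rewrite mulmxA; apply: HB.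
  by apply: dyadic_flowsM => //; exact: ltW.
- move=> bd0; exfalso.
  have x00 : (const_mx 1 : 'cV[R]_d) != 0.
    apply/eqP => /colP /(_ (Ordinal dgt0)); rewrite !mxE => /eqP; apply/negP.
    exact: oner_neq0.
  have [k Hk] : exists k : nat, forall x : 'cV[R]_d, x != 0 -> exists w,
      [/\ word_in F w, (size w <= k * 2 ^ k)%N &
      2 * `|x| <= `|word_flow (delta / 2 ^+ k) w *m x|].
    apply: contrapT => H.
    have /choice[y Hy] : forall k : nat, exists y : 'cV[R]_d, `|y| = 1 /\
        forall w, word_in F w -> (size w <= k * 2 ^ k)%N ->
        `|word_flow (delta / 2 ^+ k) w *m y| <= 2.
      move=> k; apply: contrapT => Hk; apply: H; exists k => x x0.
      apply: contrapT => Hx; apply: Hk; exists (`|x|^-1 *: x).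
      have xp : 0 < `|x| by rewrite normr_gt0.
      split; first by rewrite normrZ ger0_norm ?invr_ge0// mulVf ?gt_eqF.
      move=> w Fw sw; rewrite -scalemxAr normrZ ger0_norm ?invr_ge0//.
      rewrite ler_pdivrMl// [_ * 2]mulrC leNgt; apply/negP => h; apply: Hx; exists w; split=> //.
      exact: ltW.
    have y1 k : `|y k| <= 1 by rewrite (Hy k).1.
    have [p clp] := bounded_cluster_pt y1.
    have p1 : 1 <= `|p|.
      rewrite -lerN2; apply: (@cluster_pt_le _ _ _ y p (fun v => - `|v|) 1 _ clp).
        move=> v; rewrite mul1r -opprD normrN; exact: ler_dist_dist.
      by move=> e e0; exists 0%N => k _; rewrite (Hy k).1 lerDl ltW.
    have [_ [n [w [Fw ->]]] hg] : exists2 g, S g & 2 < `|g *m p|.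
      apply: contrapT => Hp; have /bd0 p0 : bd p.
        by exists 2 => g Sg; rewrite leNgt; apply/negP => h; apply: Hp; exists g.
      by move: p1; rewrite p0 normr0 ler10.
    move: hg; rewrite ltNge => /negP; apply.
    set g := word_flow _ _.
    apply: (@cluster_pt_le _ _ _ y p (fun v => `|g *m v|) (d%:R * `|g|) _ clp).
      move=> v; apply: le_trans (ler_dist_dist _ _) _; rewrite -mulmxBr.
      exact: normmx_mul.
    move=> e e0; exists (maxn n (size w)) => k; rewrite geq_max => /andP[nk sk].
    have [w' [Fw' sw' E]] := dyadic_flows_refine (ltW d0) nk Fw; rewrite /g -E.
    apply: le_trans ((Hy k).2 _ Fw' _) _; last by rewrite lerDl ltW.
    by rewrite sw' leq_mul// leq_pexp2l// leq_subr.
  have dk0 : 0 < delta / 2 ^+ k by rewrite divr_gt0// exprn_gt0.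
  have [A [sA]] := doubling_growth K0 HK dk0 x00 Hk.
  by rewrite (unif A sA) ltxx.
- move=> bdall.
  have /choice[B HB] : forall j : 'I_d, exists B, forall g, S g ->
      `|g *m (delta_mx j 0 : 'cV[R]_d)| <= B by move=> j; exact: bdall.
  exists (\sum_j `|B j|) => g Sg; apply: normmx_le => [|i j]; first exact: sumr_ge0.
  have := HB j g Sg; rewrite -colE => h.
  apply: le_trans (_ : `|col j g| <= _).
    by have := normmx_ge (col j g) i 0; rewrite [X in `|X| <= _]mxE.
  apply: le_trans h _.
  by rewrite (bigD1 j)//= (le_trans (ler_norm _))// lerDl sumr_ge0.
Qed.

(** The factor d compensates that of [normmx_mul]: below this threshold the word halves every vector
    and [contracting_decay] applies. *)
Lemma dyadic_flows_lower (R : realType) d (F : set 'M[R]_d) K delta : (0 < d)%N ->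
  0 < K -> (forall M, F M -> forall v : 'cV[R]_d, `|M *m v| <= K * `|v|) ->
  0 < delta -> uniform_with F 0%E ->
  forall g, dyadic_flows F delta g -> (2 * d%:R)^-1 <= `|g|.
Proof.
move=> dgt0 K0 HK d0 unif _ [n [w [Fw ->]]]; rewrite leNgt; apply/negP.
set g := word_flow _ w => hg.
have dR0 : 0 < d%:R :> R by rewrite ltr0n.
have gv (v : 'cV[R]_d) : `|g *m v| <= 2^-1 * `|v|.
  apply: le_trans (normmx_mul _ _) _; rewrite ler_wpM2r//.
  have -> : 2^-1 = d%:R * (2 * d%:R)^-1 :> R by field; rewrite gt_eqF.
  by rewrite ler_wpM2l// ltW.
have w0 : w != [::].
  apply/eqP => w0; have := gv (const_mx 1); rewrite /g w0 /= mul1mx.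
  have : 0 < `|const_mx 1 : 'cV[R]_d|.
    rewrite normr_gt0; apply/eqP => /colP /(_ (Ordinal dgt0)); rewrite !mxE => /eqP.
    apply/negP; exact: oner_neq0.
  move: (`|_|) => x; lra.
have dn0 : 0 < delta / 2 ^+ n by rewrite divr_gt0// exprn_gt0.
have [A [sA]] := contracting_decay K0 HK dn0 Fw w0 gv.
by rewrite (unif A sA) ltxx.
Qed.

(** With Y = E - 1 = t A + O(t^2), invariance reads Y^T P + P Y + Y^T P Y = 0; dividing by t leaves
    A^T P + P A = O(t). *)
Lemma invariant_form_infinitesimal (R : realType) d (A P : 'M[R]_d) delta :
  0 < delta -> delta <= 1 ->
  (forall n, (flow A (delta / 2 ^+ n))^T *m P *m flow A (delta / 2 ^+ n) = P) ->
  A^T *m P + P *m A = 0.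
Proof.
move=> d0 d1 HP; have [C C0 HC] := flow_expand_mx A.
pose D := `|A| + C; have D0 : 0 <= D by rewrite addr_ge0.
pose c := d%:R * C * `|P| + d%:R * `|P| * C + d%:R * (d%:R * D * `|P|) * D.
apply/eqP; rewrite -normr_le0; apply: (@le0_geometric _ _ (c * delta)) => n.
pose t := delta / 2 ^+ n.
have t0 : 0 < t by rewrite divr_gt0// exprn_gt0.
have t1 : t <= 1.
  by apply: le_trans d1; rewrite ler_pdivrMr ?exprn_gt0// ler_peMr ?(ltW d0)// exprn_ege1// ler1n.
have := HP n; rewrite -/t; have := HC t (ltW t0) t1.
move: (flow A t) => E hE EP.
pose G := E - 1%:M - t *: A; pose Y := E - 1%:M; rewrite -/G in hE.
have YE : Y = t *: A + G by rewrite /G /Y [RHS]addrC subrK.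
have Yn : `|Y| <= D * t.
  rewrite YE; apply: le_trans (ler_normD _ _) _; rewrite normrZ ger0_norm ?(ltW t0)//.
  rewrite /D mulrDl mulrC lerD2l; apply: le_trans hE _; rewrite ler_wpM2l//.
  by rewrite expr2 ler_piMl// ltW.
have eq0 : Y^T *m P + P *m Y + Y^T *m P *m Y = 0.
  have : (1%:M + Y)^T *m P *m (1%:M + Y) = P by rewrite /Y addrC subrK.
  have -> : (1%:M + Y)^T = 1%:M + Y^T by rewrite linearD/= trmx1.
  rewrite !mulmxDl mul1mx !mulmxDr !mulmx1.
  move: (P *m Y) (Y^T *m P) (Y^T *m P *m Y) => p q r h; apply: (addrI P).
  by rewrite addr0 -[RHS]h; apply/matrixP => i j; rewrite !mxE; ring.
have YT : Y^T = t *: A^T + G^T by rewrite YE linearD/= linearZ.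
have YP : Y^T *m P = t *: (A^T *m P) + G^T *m P by rewrite YT mulmxDl -scalemxAl.
have PY : P *m Y = t *: (P *m A) + P *m G by rewrite YE mulmxDr -scalemxAr.
have {}eq0 : t *: (A^T *m P) + G^T *m P + (t *: (P *m A) + P *m G) + Y^T *m P *m Y = 0.
  by rewrite -YP -PY.
have e : t *: (A^T *m P + P *m A) = - (G^T *m P + P *m G + Y^T *m P *m Y).
  apply/eqP; rewrite -subr_eq0 opprK -[X in _ == X]eq0 scalerDr; apply/eqP.
  move: (A^T *m P) (P *m A) (G^T *m P) (P *m G) (Y^T *m P *m Y) => ? ? ? ? ?.
  by apply/matrixP => i j; rewrite !mxE; ring.
have h : t * `|A^T *m P + P *m A| <= t * (c * t).
  rewrite -{1}[t]ger0_norm ?(ltW t0)// -normrZ e normrN.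
  have -> : t * (c * t) = d%:R * (C * t ^+ 2) * `|P| + d%:R * `|P| * (C * t ^+ 2) +
    d%:R * (d%:R * (D * t) * `|P|) * (D * t) by rewrite /c; ring.
  apply: le_trans (ler_normD _ _) _; apply: lerD.
    apply: le_trans (ler_normD _ _) _; apply: lerD.
      by apply: le_trans (normmx_mul _ _) _; rewrite normmx_tr ler_wpM2r// ler_wpM2l.
    by apply: le_trans (normmx_mul _ _) _; rewrite ler_wpM2l ?mulr_ge0.
  apply: le_trans (normmx_mul _ _) _; apply: ler_pM => //.
  rewrite ler_wpM2l//; apply: le_trans (normmx_mul _ _) _.
  by rewrite normmx_tr ler_wpM2r// ler_wpM2l.
by move: h; rewrite ler_pM2l// /t mulrA.
Qed.

(** * The two implications and the spheres *)

Lemma uniform_antisymmetric (R : realType) (d : nat) (F : set 'M[R]_d) : (0 < d)%N ->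
  compact F -> irreducible_family F -> uniform_with F 0%E ->
  exists B : 'M[R]_d, B \in unitmx /\ antisymmetric_in F B.
Proof.
move=> dgt0 Fc Firr unif; have [K K0 HK] := compact_family_bound Fc.
(* The bound 1 is for the second-order expansion of flows, 1 / (2 K) for their invertibility by
   [flow_ge]. *)
pose delta := Num.min 1 (2^-1 / K).
have d0 : 0 < delta by rewrite lt_min ltr01 divr_gt0// invr_gt0.
have d1 : delta <= 1 by rewrite ge_min lexx.
have Kd : K * delta <= 2^-1 by rewrite mulrC -ler_pdivlMr// ge_min lexx orbT.
have Sirr := dyadic_flows_irreducible d0 d1 Firr.
have [B HB] := dyadic_flows_bounded dgt0 K0 HK d0 Sirr unif.
have eta0 : 0 < (2 * d%:R)^-1 :> R by rewrite invr_gt0 mulr_gt0// ltr0n.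
have [P [Ps [c c0 Pc] PS]] : exists P : 'M[R]_d, [/\ P^T = P,
    (exists2 c, 0 < c & forall v, c * `|v| ^+ 2 <= qform P v) &
    forall g, dyadic_flows F delta g -> g^T *m P *m g = P].
  apply: (irreducible_bounded_form (M := B) dgt0 (dyadic_flows1 F delta) _ Sirr _ eta0).
  - by move=> g h; apply: dyadic_flowsM; exact: ltW.
  - by move=> g; exact: dyadic_flows_unit Kd.
  - by move=> g Sg; rewrite HB// (dyadic_flows_lower dgt0 K0 HK d0 unif).
have Ppos : posdef P.
  by move=> v v0; apply: lt_le_trans (Pc v); rewrite mulr_gt0// exprn_gt0// normr_gt0.
have [T Tu PT] := cholesky Ps Ppos.
(* As P = T^T T, the columns of T^-1 are orthonormal for P. *)
exists (invmx T); split; first by rewrite unitmx_inv.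
move=> A FA; rewrite /matrix_in_basis invmxK.
have := @invariant_form_infinitesimal _ _ A P delta d0 d1 _; rewrite PT => H.
have {}H : A^T *m (T^T *m T) + T^T *m T *m A = 0.
  by apply: H => n; rewrite -PT; apply: PS; exact: dyadic_flows_letter.
have := congr1 (fun X => (invmx T)^T *m X *m invmx T) H.
rewrite /= mulmx0 mul0mx mulmxDr mulmxDl !mulmxA mulmxK//.
rewrite -[(invmx T)^T *m T^T]trmx_mul mulmxV// trmx1 mul1mx => /eqP.
by rewrite addr_eq0 => /eqP <-; rewrite !trmx_mul mulmxA.
Qed.

Lemma antisymmetric_infinitesimal (R : realType) (d : nat) (F : set 'M[R]_d) B M :
  B \in unitmx -> antisymmetric_in F B -> F M ->
  M^T *m ((invmx B)^T *m invmx B) + (invmx B)^T *m invmx B *m M = 0.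
Proof.
move=> Bu HB FM; have := HB M FM; rewrite /matrix_in_basis => H.
have := congr1 (fun X => (invmx B)^T *m X *m invmx B) H.
rewrite !trmx_mul mulmxN mulNmx !mulmxA mulmxK//.
rewrite -[(invmx B)^T *m B^T]trmx_mul mulmxV// trmx1 mul1mx => ->.
by rewrite addNr.
Qed.

Lemma qform_coords (R : realType) (d : nat) (B : 'M[R]_d) v :
  qform ((invmx B)^T *m invmx B) v = \sum_i (coords B v) i 0 ^+ 2.
Proof.
have -> : (invmx B)^T *m invmx B = (invmx B)^T *m 1%:M *m invmx B by rewrite mulmx1.
rewrite qform_mul /qform mulmx1 mxE; apply: eq_bigr => i _.
by rewrite mxE expr2.
Qed.

Lemma trajectory_sphere (R : realType) (d : nat) (F : set 'M[R]_d) B A x0 x t :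
  compact F -> B \in unitmx -> antisymmetric_in F B ->
  switching_law F A -> trajectory A x0 x -> 0 <= t ->
  qform ((invmx B)^T *m invmx B) (x t) = qform ((invmx B)^T *m invmx B) (x 0).
Proof.
move=> Fc Bu HB sA tx t0; have [K K0 HK] := compact_family_bound Fc.
apply: (quadratic_form_constant (switching_law_bounded K0 HK sA) tx) => //.
  by rewrite trmx_mul trmxK.
by move=> s s0; apply: antisymmetric_infinitesimal Bu HB _; exact: sA.1.
Qed.

(** Constancy of Q bounds all trajectories above, and one nonzero trajectory below; the latter
    exists because d > 0, whereas in dimension 0 the exponent would be -oo. *)
Lemma antisymmetric_uniform (R : realType) (d : nat) (F : set 'M[R]_d) B : (0 < d)%N ->
  compact F -> B \in unitmx -> antisymmetric_in F B -> uniform_with F 0%E.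
Proof.
move=> dgt0 Fc Bu HB A sA; have [K K0 HK] := compact_family_bound Fc.
have bA := switching_law_bounded K0 HK sA.
set Q := (invmx B)^T *m invmx B.
have const x0 x t (tx : trajectory A x0 x) := trajectory_sphere Fc Bu HB sA tx (t := t).
have low v : `|invmx B *m v| ^+ 2 <= qform Q v.
  have -> : Q = (invmx B)^T *m 1%:M *m invmx B by rewrite mulmx1.
  by rewrite qform_mul; exact: qform1.
have Q0 v : 0 <= qform Q v by apply: le_trans (low v); exact: sqr_ge0.
apply/eqP; rewrite eq_le; apply/andP; split.
  apply: ge_ereal_sup => _ [x [x0 tx] <-].
  apply: (@growth_rate_le _ _ _ _ (d%:R * `|B| * Num.sqrt (qform Q (x 0)) + 1) 0).
    by rewrite ltr_wpDl// !mulr_ge0// sqrtr_ge0.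
  move=> t t0; rewrite mul0r expR0 mulr1 -(const _ _ _ tx t0).
  apply: le_trans (_ : d%:R * `|B| * Num.sqrt (qform Q (x t)) <= _); last by rewrite lerDl.
  rewrite -{1}[x t](mulKVmx Bu); apply: le_trans (normmx_mul _ _) _.
  rewrite ler_wpM2l ?mulr_ge0//.
  by rewrite -[leLHS]ger0_norm// -sqrtr_sqr ler_wsqrtr.
pose v0 : 'cV[R]_d := const_mx 1.
have v00 : v0 != 0.
  apply/eqP => /colP /(_ (Ordinal dgt0)); rewrite !mxE => /eqP; apply/negP.
  exact: oner_neq0.
have [x tx] := trajectory_exists v0 bA.
apply: (@le_trans _ _ (growth_rate x)); last first.
  by apply: ereal_sup_ubound; exists x => //; exists v0.
have x0E : x 0 = v0.
  have [cx xE] := tx; apply/colP => i; rewrite (xE 0 (lexx _) i).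
  rewrite -[X in _ + X]/(primitive _ 0) primitive0 ?addr0//.
  exact: law_field_integrable bA cx.
have q0 : 0 < qform Q v0.
  apply: lt_le_trans (low v0); rewrite exprn_gt0// normr_gt0.
  apply/eqP => h; move/eqP: v00; apply.
  by rewrite -[v0](mulKVmx Bu) h mulmx0.
have [c c0 Hc] := bilinear_bound Q.
have c1 : 0 < c + 1 by rewrite ltr_wpDl.
(* From Q(v0) = Q(x t) <= c |x t|^2; c + 1 makes the denominator positive. *)
apply: (@growth_rate_ge _ _ _ _ (Num.sqrt (qform Q v0 / (c + 1)))).
  by rewrite sqrtr_gt0 divr_gt0.
move=> T; exists (Num.max T 0); first by rewrite le_max lexx.
set t := Num.max T 0; have t0 : 0 <= t by rewrite le_max lexx orbT.
rewrite mul0r expR0 mulr1 -[leRHS]ger0_norm// -sqrtr_sqr ler_wsqrtr//.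
rewrite ler_pdivrMr// -x0E -(const _ _ _ tx t0).
apply: le_trans (ler_norm _) _; apply: le_trans (Hc _ _) _.
by rewrite -expr2 mulrC ler_wpM2l ?sqr_ge0// lerDl.
Qed.

Theorem theorem10 (R : realType) (d : nat) (d_gt0 : (0 < d)%N)
    (F : set 'M[R]_d) (F_compact : compact F) (F_irr : irreducible_family F) :
  (uniform_with F 0%E <->
     exists B : 'M[R]_d, B \in unitmx /\ antisymmetric_in F B) /\
  (forall B : 'M[R]_d, B \in unitmx -> antisymmetric_in F B ->
     forall (A : R -> 'M[R]_d) (x0 : 'cV[R]_d) (x : R -> 'cV[R]_d),
       switching_law F A -> trajectory A x0 x ->
       exists r : R, forall t : R, 0 <= t -> euclidean_sphere B r (x t)).
Proof.
split; first split.
- exact: uniform_antisymmetric.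
- by move=> [B [Bu HB]]; exact: antisymmetric_uniform Bu HB.
- move=> B Bu HB A x0 x sA tx.
  exists (Num.sqrt (qform ((invmx B)^T *m invmx B) (x 0))) => t t0.
  rewrite /euclidean_sphere /= -qform_coords.
  by rewrite (trajectory_sphere F_compact Bu HB sA tx t0).
Qed.
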